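(* Let $d,m,M,N\ge 1$ be integers, $T>0$, let $U\subset\mathbb{R}^m$ be a compact set and $\mathcal{U}:=L^2([0,T],U)$. Let $F:\mathbb{R}^d\times\mathbb{R}^m\to\mathbb{R}^d$ be continuous and $C^2$-regular in the first variable, and assume there exists $C>0$ such that $$|F(x,\omega)-F(y,\omega)|_2\le C(|\omega|_2+1)|x-y|_2\qquad\text{for all }x,y\in\mathbb{R}^d,\ \omega\in\mathbb{R}^m.$$ For every $i=1,\dots,M$ let $g_i:\mathbb{R}^d\to\mathbb{R}$ be convex, $C^1$-regular and bounded from below. Let $x_i^0\in\mathbb{R}^d$ and $\alpha_i^j\in\mathbb{R}^d$ be given for $i=1,\dots,M$, $j=1,\dots,N$. For $u\in\mathcal{U}$ let $x_i^j:[0,T]\to\mathbb{R}^d$ be the solution of $$\dot x_i^j(t)=F(x_i^j(t),u(t))\ \text{ for a.e. }t\in[0,T],\qquad x_i^j(0)=x_i^0+\alpha_i^j,$$ and consider the minimization over $u\in\mathcal{U}$ of $$J(u)=\frac1M\sum_{i=1}^M\max_{j=1,\dots,N}g_i\big(x_i^j(T)\big).$$ Let $(\bar u,\bar X)$, $\bar X=(\bar x_i^j)_{i=1,\dots,M}^{j=1,\dots,N}$, be a strong local minimizer for this problem. Then there exist coefficients $(\gamma_i^j)_{i=1,\dots,M}^{j=1,\dots,N}$ with $\gamma_i^j\ge 0$ and $\sum_{j=1}^N\gamma_i^j=1$ for every $i=1,\dots,M$, and a curve $P=(p_i^j)_{i=1,\dots,M}^{j=1,\dots,N}:[0,T]\to\big((\mathbb{R}^{d\times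 N})^M\big)^\star$ whose components solve the adjoint equations $$\begin{cases}\dot p_i^j(t)=-\,p_i^j(t)\,\nabla_xF\big(\bar x_i^j(t),\bar u(t)\big)&\text{for a.e. }t\in[0,T],\\ p_i^j(T)=-\frac1M\gamma_i^j\,\nabla_xg_i\big(\bar x_i^j(T)\big),\end{cases}$$ such that for a.e. $t\in[0,T]$ $$H(\bar X(t),P(t),\bar u(t))=\max_{\omega\in U}H(\bar X(t),P(t),\omega),$$ where $H(X,P,\omega)=\sum_{i=1}^M\sum_{j=1}^N p_i^j\cdot F(x_i^j,\omega)$. Moreover, for every $i=1,\dots,M$, if $\gamma_i^j>0$ then $j\in\operatorname{argmax}_{k=1,\dots,N}\,g_i\big(\bar x_i^k(T)\big)$.
   Context: An admissible process is a pair $(u,X)$ where $u\in\mathcal{U}$ and $X=(x_i^j)_{i=1,\dots,M}^{j=1,\dots,N}:[0,T]\to(\mathbb{R}^{d\times N})^M$ is the corresponding collection of (absolutely continuous) solutions of $\dot x_i^j=F(x_i^j,u)$ with $x_i^j(0)=x_i^0+\alpha_i^j$. An admissible process $(\bar u,\bar X)$ is a strong local minimizer for $J$ if there exists $\varepsilon>0$ such that for every other admissible process $(u,X)$ with $\|X(\cdot)-\bar X(\cdot)\|_{C^0}\le\varepsilon$ (sup-norm over $[0,T]$) one has $$\frac1M\sum_{i=1}^M\max_{j=1,\dots,N}g_i(\bar x_i^j(T))\le\frac1M\sum_{i=1}^M\max_{j=1,\dots,N}g_i(x_i^j(T)).$$ $\nabla_xF(x,\omega)$ is the Jacobian matrix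 of $F(\cdot,\omega)$ at $x$; the covectors $p_i^j(t)$ and the gradients $\nabla_x g_i$ are regarded as row vectors in $(\mathbb{R}^d)^\star$, and $p_i^j\,\nabla_xF$ is the row vector–matrix product. Solutions of the adjoint equations are absolutely continuous curves. Elements of $L^2([0,T],U)$ are square-integrable functions taking values in $U$ a.e. *)

(* Defs.v *)
From HB Require Import structures.
From mathcomp Require Import all_boot all_order all_algebra.
From mathcomp Require Import all_classical all_reals all_analysis.

Set Implicit Arguments.
Unset Strict Implicit.
Unset Printing Implicit Defensive.

Import Order.TTheory GRing.Theory Num.Theory.
Import numFieldNormedType.Exports.

Local Open Scope classical_set_scope.
Local Open Scope ring_scope.

(* Points of R^n and covectors in (R^n)^* are both
   represented by row vectors 'rV[R]_n. An ensemble of curves x_i^j is a family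
   X : 'I_M -> 'I_N -> R -> 'rV[R]_d, of which only the restriction to the time
   interval [0, T] matters. *)

Section Definitions.
Context {R : realType}.

Local Notation mu := (@lebesgue_measure R).

(* The norm that the library puts on 'rV[R]_n is the sup-norm; it induces the
   same topology and derivatives as this one. *)
Definition enorm n (v : 'rV[R]_n) : R := Num.sqrt (\sum_(k < n) v ord0 k ^+ 2).

Definition pairing n (p v : 'rV[R]_n) : R := \sum_(k < n) p ord0 k * v ord0 k.

Definition C1 n (V : normedModType R) (f : 'rV[R]_n -> V) : Prop :=
  (forall x, differentiable f x) /\ (forall v, continuous (fun x => 'D_v f x)).

Definition C2 n (V : normedModType R) (f : 'rV[R]_n -> V) : Prop :=
  C1 f /\ (forall v, C1 (fun x => 'D_v f x)).

(* The library's 'J f x acts on row vectors from the right, i.e. its (k, l)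
   entry is the k-th partial derivative of f_l; the usual Jacobian matrix, with
   (l, k) entry the k-th partial derivative of f_l, is its transpose. *)
Definition Jac n m (f : 'rV[R]_n -> 'rV[R]_m) (x : 'rV[R]_n) : 'M[R]_(m, n) :=
  (jacobian f x)^T.

Definition grad n (g : 'rV[R]_n -> R) (x : 'rV[R]_n) : 'rV[R]_n :=
  \row_(k < n) 'D_(delta_mx ord0 k) g x.

Definition abs_continuous n (a b : R) (f : R -> 'rV[R]_n) : Prop :=
  forall e : R, 0 < e -> exists2 delta : R, 0 < delta &
  forall (K : nat) (l r : 'I_K -> R),
    (forall k, [/\ a <= l k, l k <= r k & r k <= b]) ->
    (forall k k', k != k' -> r k <= l k' \/ r k' <= l k) ->
    \sum_(k < K) (r k - l k) < delta ->
    \sum_(k < K) enorm (f (r k) - f (l k)) < e.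

(* Representatives of the elements of L^2([0, T], U). *)
Definition control m (T : R) (U : set 'rV[R]_m) (u : R -> 'rV[R]_m) : Prop :=
  [/\ forall k, measurable_fun `[0, T] (fun t => u t ord0 k),
      mu.-integrable `[0, T] (fun t => (enorm (u t) ^+ 2)%:E) &
      \forall t \ae mu, t \in `[0, T] -> U (u t)].

Definition trajectory d m (T : R) (F : 'rV[R]_d -> 'rV[R]_m -> 'rV[R]_d)
    (u : R -> 'rV[R]_m) (x0 : 'rV[R]_d) (x : R -> 'rV[R]_d) : Prop :=
  [/\ abs_continuous 0 T x,
      \forall t \ae mu, t \in `[0, T] -> is_derive t (1 : R) x (F (x t) (u t)) &
      x 0 = x0].

Definition admissible d m M N (T : R) (U : set 'rV[R]_m)
    (F : 'rV[R]_d -> 'rV[R]_m -> 'rV[R]_d)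
    (x0 : 'I_M -> 'rV[R]_d) (alpha : 'I_M -> 'I_N -> 'rV[R]_d)
    (u : R -> 'rV[R]_m) (X : 'I_M -> 'I_N -> R -> 'rV[R]_d) : Prop :=
  control T U u /\
  forall i j, trajectory T F u (x0 i + alpha i j) (X i j).

Definition dist_C0 d M N (T : R) (X Y : 'I_M -> 'I_N -> R -> 'rV[R]_d) : \bar R :=
  ereal_sup [set (Num.sqrt (\sum_(i < M) \sum_(j < N)
                    enorm (X i j t - Y i j t) ^+ 2))%:E | t in `[0, T]].

Definition ord_max_val N (f : 'I_N.+1 -> R) : R :=
  \big[Num.max/f ord0]_(j < N.+1) f j.

Definition cost d M N (T : R) (g : 'I_M -> 'rV[R]_d -> R)
    (X : 'I_M -> 'I_N.+1 -> R -> 'rV[R]_d) : R :=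
  M%:R^-1 * \sum_(i < M) ord_max_val (fun j => g i (X i j T)).

Definition strong_local_minimizer d m M N (T : R) (U : set 'rV[R]_m)
    (F : 'rV[R]_d -> 'rV[R]_m -> 'rV[R]_d) (g : 'I_M -> 'rV[R]_d -> R)
    (x0 : 'I_M -> 'rV[R]_d) (alpha : 'I_M -> 'I_N.+1 -> 'rV[R]_d)
    (ubar : R -> 'rV[R]_m) (Xbar : 'I_M -> 'I_N.+1 -> R -> 'rV[R]_d) : Prop :=
  admissible T U F x0 alpha ubar Xbar /\
  exists2 e : R, 0 < e &
    forall u X, admissible T U F x0 alpha u X ->
      (dist_C0 T X Xbar <= e%:E)%E -> cost T g Xbar <= cost T g X.

Definition adjoint_curve d m (T : R) (F : 'rV[R]_d -> 'rV[R]_m -> 'rV[R]_d)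
    (u : R -> 'rV[R]_m) (x : R -> 'rV[R]_d) (pT : 'rV[R]_d)
    (p : R -> 'rV[R]_d) : Prop :=
  [/\ abs_continuous 0 T p,
      \forall t \ae mu, t \in `[0, T] ->
        is_derive t (1 : R) p (- (p t *m Jac (F ^~ (u t)) (x t))) &
      p T = pT].

Definition hamiltonian d m M N (F : 'rV[R]_d -> 'rV[R]_m -> 'rV[R]_d)
    (X P : 'I_M -> 'I_N -> 'rV[R]_d) (w : 'rV[R]_m) : R :=
  \sum_(i < M) \sum_(j < N) pairing (P i j) (F (X i j) w).

Definition is_max (A : set R) (v : R) : Prop := A v /\ ubound A v.

Definition argmax (I : Type) (f : I -> R) : set I :=
  [set j | forall k, f k <= f j].

End Definitions.

(* Main.v *)
Require Import Defs.
From mathcomp Require Import all_boot all_order all_algebra.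
From mathcomp Require Import all_classical all_reals all_analysis.
From mathcomp Require Import measurable_realfun ring lra.

Set Implicit Arguments.
Unset Strict Implicit.

Import Order.TTheory GRing.Theory Num.Theory.
Import numFieldNormedType.Exports.

Local Open Scope classical_set_scope.
Local Open Scope ring_scope.

(** The maximum condition must hold for all [w] outside a single null set of times. For a fixed
    value [w] the integrand q . F(x, w) is continuous in time, so its primitive is differentiable at
    every interior time; exceptional times come only from q . F(x, u), which does not involve [w]. A
    needle uses only the differentiability of these primitives at its base point. A maximum over j
    is not differentiable, so for each choice of weights c optimality yields only some selection
    sigma, which depends on c. Selections are vertices of a product of simplices, and passing to
    this compact convex set is what allows one multiplier to be extracted from all the weights.
    Competitors are obtained by Picard iteration started at the optimal trajectory itself, with an
    exponential weight that makes the iteration contract on all of [0, T]; existence and the O(eps)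
    distance then come from one estimate. *)

(** The adjoint covectors [q i j] are taken with terminal value
    [- M^-1 grad g_i] and the multipliers [gamma i j] enter afterwards, by
    [p i j = gamma i j *: q i j].  Replacing the optimal control by [w_k] on short
    intervals based at [t_k], of length [c_k * eps], changes [g_i (x i j T)] by
    [- eps * M * \sum_k c_k h_ijk + o(eps)], where [h_ijk] is the increment of
    [q i j . F] at [t_k]; this follows by differentiating [q i j . (y - x)], without
    the linearized flow.  Optimality forbids that [\sum_i \sum_k c_k h_{i,sigma(i),k}]
    be positive for every choice [sigma] of active indices, and a theorem of the
    alternative gives a [gamma] that works for the finitely many pairs [(t_k, w_k)].
    The admissible [gamma] form a compact set, so by the finite intersection property
    one [gamma] works for all pairs [(t, w)] with [t] a differentiability point of the
    integrals of [q i j . F (x i j, u)], that is for a.e. [t]. *)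

(** * Integrals of bounded measurable functions *)

Section Primitive.
Context {R : realType}.
Local Notation mu := (@lebesgue_measure R).
Implicit Types (h f : R -> R) (a b c t s K : R).

(** Taken on the whole line rather than on [0, T], so that integrability on every compact interval
    is automatic. *)
Definition bmeas h := measurable_fun setT h /\ exists K, forall s, `|h s| <= K.

Definition prim h (t : R) : R := \int[mu]_(s in `[0, t]) h s.

Lemma bmeas_integrable h a b : bmeas h -> mu.-integrable `[a, b] (EFin \o h).
Proof.
move=> [mh [K hK]]; apply: measurable_bounded_integrable => //.
- by rewrite /= lebesgue_measure_itv; case: ifP => // _; rewrite -EFinD ltry.
- exact: measurable_funTS.
- exists K; split; first exact: num_real.
  by move=> x Kx s _; exact: le_trans (hK s) (ltW Kx).
Qed.

Lemma bmeas_cst c : bmeas (fun=> c).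
Proof. by split; [exact: measurable_cst | exists `|c|]. Qed.

Lemma bmeasD h f : bmeas h -> bmeas f -> bmeas (fun s => h s + f s).
Proof.
move=> [mh [K hK]] [mf [L fL]]; split; first exact: measurable_funD.
by exists (K + L) => s; apply: le_trans (ler_normD _ _) (lerD _ _).
Qed.

Lemma bmeasM h f : bmeas h -> bmeas f -> bmeas (fun s => h s * f s).
Proof.
move=> [mh [K hK]] [mf [L fL]]; split; first exact: measurable_funM.
by exists (K * L) => s; rewrite normrM ler_pM.
Qed.

Lemma bmeasN h : bmeas h -> bmeas (fun s => - h s).
Proof.
move=> bh; have := bmeasM (bmeas_cst (-1)) bh.
by under eq_fun do rewrite mulN1r.
Qed.

Lemma bmeasB h f : bmeas h -> bmeas f -> bmeas (fun s => h s - f s).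
Proof. by move=> bh bf; apply: bmeasD => //; exact: bmeasN. Qed.

Lemma bmeas_sum n (h : 'I_n -> R -> R) : (forall k, bmeas (h k)) ->
  bmeas (fun s => \sum_(k < n) h k s).
Proof.
elim: n h => [|n IH] h bh.
  under eq_fun do rewrite big_ord0.
  exact: bmeas_cst.
under eq_fun do rewrite big_ord_recr /=.
by apply: bmeasD => //; exact: IH.
Qed.

Lemma bmeas_abs h : bmeas h -> bmeas (fun s => `|h s|).
Proof.
move=> [mh [K hK]]; split; first exact: measurableT_comp.
by exists K => s; rewrite normr_id.
Qed.

(** Meant for the Jacobian along a trajectory, a pointwise limit of difference quotients. *)
Lemma bmeas_cvg (h_ : nat -> R -> R) h K :
  (forall n, measurable_fun setT (h_ n)) -> (forall s, h_ ^~ s @ \oo --> h s) ->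
  (forall s, `|h s| <= K) -> bmeas h.
Proof.
move=> mh hh hK; split; last by exists K.
by apply: (measurable_fun_cvg mh) => s _; exact: hh.
Qed.

Lemma prim0 h : prim h 0 = 0.
Proof. by rewrite /prim set_itv1 Rintegral_set1. Qed.

Lemma prim_cst c t : 0 <= t -> prim (fun=> c) t = c * t.
Proof.
move=> t0; rewrite /prim Rintegral_cst //= lebesgue_measure_itv /= lte_fin.
case: ltgtP t0 => // [t0 _|<- _]; last by rewrite !mulr0.
by rewrite /= oppr0 addr0.
Qed.

Lemma primD h f t : bmeas h -> bmeas f ->
  prim (fun s => h s + f s) t = prim h t + prim f t.
Proof. by move=> bh bf; apply: RintegralD => //; exact: bmeas_integrable. Qed.

Lemma primB h f t : bmeas h -> bmeas f ->
  prim (fun s => h s - f s) t = prim h t - prim f t.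
Proof. by move=> bh bf; apply: RintegralB => //; exact: bmeas_integrable. Qed.

Lemma primZ c h t : bmeas h -> prim (fun s => c * h s) t = c * prim h t.
Proof. by move=> bh; apply: RintegralZl => //; exact: bmeas_integrable. Qed.

Lemma prim_sum n (h : 'I_n -> R -> R) t : (forall k, bmeas (h k)) ->
  prim (fun s => \sum_(k < n) h k s) t = \sum_(k < n) prim (h k) t.
Proof.
elim: n h => [|n IH] h bh.
  rewrite big_ord0 /prim; under eq_Rintegral do rewrite big_ord0.
  by rewrite Rintegral_cst //= mul0r.
rewrite big_ord_recr /= -IH // -primD //; last exact: bmeas_sum.
by rewrite /prim; under eq_Rintegral do rewrite big_ord_recr /=.
Qed.

Lemma prim_le h f t : bmeas h -> bmeas f ->
  (forall s : R, 0 <= s <= t -> h s <= f s) -> prim h t <= prim f t.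
Proof.
move=> bh bf hf; apply: le_Rintegral => //; try exact: bmeas_integrable.
Qed.

Lemma eq_prim h f t : (forall s : R, 0 <= s <= t -> h s = f s) -> prim h t = prim f t.
Proof. by move=> hf; apply: eq_Rintegral => s; rewrite inE /= in_itv /=; exact: hf. Qed.

Lemma prim_norm h t : bmeas h -> `|prim h t| <= prim (fun s => `|h s|) t.
Proof. by move=> bh; apply: le_normr_Rintegral => //; exact: bmeas_integrable. Qed.

Lemma prim_itvB h a b : bmeas h -> 0 <= a -> a <= b ->
  prim h b - prim h a = \int[mu]_(s in `]a, b]) h s.
Proof.
move=> bh a0 ab; rewrite /prim Rintegral_itvB //.
exact: bmeas_integrable.
Qed.

Lemma prim_lip h K a b : bmeas h -> (forall s, `|h s| <= K) -> 0 <= a -> 0 <= b ->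
  `|prim h b - prim h a| <= K * `|b - a|.
Proof.
move=> bh hK; wlog ab : a b / a <= b.
  move=> H a0 b0; have [ab|/ltW ba] := leP a b; first exact: H.
  by rewrite distrC (distrC b) H.
move=> a0 b0; rewrite prim_itvB // [`|b - a|]ger0_norm ?subr_ge0 //.
have ih : mu.-integrable `]a, b] (EFin \o h).
  apply: (integrableS _ _ _ (bmeas_integrable a b bh)) => //=.
  exact: subset_itv_oc_cc.
have iK c : mu.-integrable `]a, b] (EFin \o (fun=> c)).
  apply: (integrableS _ _ _ (bmeas_integrable a b (bmeas_cst c))) => //=.
  exact: subset_itv_oc_cc.
apply: le_trans (le_normr_Rintegral _ ih) _ => //.
have -> : K * (b - a) = \int[mu]_(s in `]a, b]) K.
  rewrite Rintegral_cst //= lebesgue_measure_itv /= lte_fin.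
  by case: ltgtP ab => // -> _; rewrite subrr.
apply: le_Rintegral => //.
by apply: integrable_norm.
Qed.

Lemma prim_ae h : bmeas h ->
  {ae mu, forall t : R, 0 < t -> is_derive t (1 : R) (prim h) (h t)}.
Proof.
move=> bh; have [mh [K hK]] := bh.
have := @FTC1 R h (BLeft 0).
move=> /(_ (fun y => bmeas_integrable 0 y bh)).
(* Lebesgue differentiation, through [FTC1], asks for local integrability on the whole line. *)
have lh : locally_integrable [set: R] h.
  split => // [|A _ cA]; first exact: openT.
  have [M [_ MA]] := compact_bounded cA.
  have mA := compact_measurable cA.
  apply: (@le_lt_trans _ _ (\int[mu]_(x in A) (cst K%:E x))%E).
    apply: ge0_le_integral => //=.
    - by apply/measurable_EFinP; apply: measurableT_comp => //; exact: measurable_funTS.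

    - by move=> x _; rewrite lee_fin.
  rewrite integral_cst //= lte_mul_pinfty ?lee_fin ?(le_trans _ (hK 0)) //.
  exact: compact_finite_measure.
move=> /(_ lh) /=; apply: filterS; first exact: (ae_filter_ringOfSetsType mu).
move=> t H t0.
have [] := H t0.
move=> dt; rewrite derive1E => e; rewrite -e; exact: derivableP.
Qed.

Lemma prim_dct (h_ : nat -> R -> R) h (K t : R) :
  (forall n, measurable_fun setT (h_ n)) -> (forall n s, `|h_ n s| <= K) ->
  (forall s : R, 0 <= s <= t -> h_ ^~ s @ \oo --> h s) -> measurable_fun setT h ->
  (fun n => prim (h_ n) t) @ \oo --> prim h t.
Proof.
move=> mh hK hh mh'.
have b1 : bmeas (fun=> K) by exact: bmeas_cst.
have [] := @dominated_convergence _ _ _ mu `[0, t]%classic _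
  (fun n s => (h_ n s)%:E) (EFin \o h) (EFin \o cst K).
- by [].
- by move=> n; apply/measurable_EFinP; apply: measurable_funTS; exact: mh.
- by apply/measurable_EFinP; exact: measurable_funTS.
- apply: aeW => s /=; rewrite in_itv /= => st; apply/fine_cvgP; split.
  exact: nearW.
  exact: hh.
- exact: bmeas_integrable.
- by apply: aeW => s n _; rewrite /= lee_fin.
move=> ih _ H; have E : (\int[mu]_(x in `[0%R, t]) (h x)%:E)%E = (prim h t)%:E.
  by rewrite /prim /Rintegral fineK //; exact: integrable_fin_num.
rewrite E in H;  move/fine_cvg: H => H.
exact: H.
Qed.

End Primitive.

(** * Absolute continuity *)

Section AbsolutelyContinuous.
Context {R : realType}.
Local Notation mu := (@lebesgue_measure R).
Implicit Types (f h : R -> R) (a b t e : R).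

(** The endpoints form a null set; discarding them leaves room for two-sided derivatives. *)
Lemma ae_itv_interior a b : {ae mu, forall t, t \in `[a, b] -> a < t < b}.
Proof.
exists [set a; b]; split.
- by apply: measurableU; exact: measurable_set1.
- rewrite measureU0; last exact: lebesgue_measure_set1; first last.
    exact: measurable_set1.
    exact: measurable_set1.
  exact: lebesgue_measure_set1.
- move=> t /= H; apply: contrapT => /not_orP[ta tb]; apply: H.
  rewrite in_itv /= !lt_neqAle => /andP[-> ->]; rewrite !andbT.
  by apply/andP; split; apply/eqP => ?; [exact: ta | exact: tb].
Qed.

(** Scalar counterpart of [abs_continuous], to which each coordinate of a trajectory reduces. *)
Definition ac a b f : Prop :=
  forall e, 0 < e -> exists2 delta : R, 0 < delta &
  forall (K : nat) (l r : 'I_K -> R),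
    (forall k, [/\ a <= l k, l k <= r k & r k <= b]) ->
    (forall k k', k != k' -> r k <= l k' \/ r k' <= l k) ->
    \sum_(k < K) (r k - l k) < delta ->
    \sum_(k < K) `|f (r k) - f (l k)| < e.

Lemma lipschitz_ac a b f L :
  (forall s t, a <= s <= b -> a <= t <= b -> `|f t - f s| <= L * `|t - s|) ->
  ac a b f.
Proof.
(* [L] may be zero or negative, so the modulus is built from |L| + 1. *)
move=> Lf e e0; have L1 : 0 < `|L| + 1 by rewrite ltr_wpDl.
exists (e / (`|L| + 1)); first exact: divr_gt0.
move=> K l r lr _; rewrite ltr_pdivlMr // => H; apply: le_lt_trans H.
rewrite mulr_suml; apply: ler_sum => k _; have [al lr_ rb] := lr k.
have := Lf (l k) (r k); rewrite al rb (le_trans lr_ rb) (le_trans al lr_) /=.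
move=> /(_ isT isT) /le_trans; apply.
rewrite ger0_norm ?subr_ge0 // mulrC ler_wpM2l ?subr_ge0 //.
by rewrite (le_trans (ler_norm _)) // lerDl.
Qed.

Lemma acB a b f h : ac a b f -> ac a b h -> ac a b (fun t => f t - h t).
Proof.
move=> acf ach e e0; have e2 : 0 < e / 2 by rewrite divr_gt0.
have [d1 d10 H1] := acf _ e2; have [d2 d20 H2] := ach _ e2.
exists (Num.min d1 d2); first by rewrite lt_min d10.
move=> K l r lr nov; rewrite lt_min => /andP[s1 s2].
have := H1 K l r lr nov s1; have := H2 K l r lr nov s2 => h2 h1.
apply: (@le_lt_trans _ _ (\sum_(k < K) `|f (r k) - f (l k)| +
   \sum_(k < K) `|h (r k) - h (l k)|)); last by lra.
rewrite -big_split /=; apply: ler_sum => k _.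
apply: le_trans (ler_normB _ _).
by rewrite le_eqVlt; apply/orP; left; apply/eqP; congr `|_|; ring.
Qed.

(* Continuous induction along [a, b]: a point outside the null set extends the
   estimate at slope e, a point of the null set adds to the list s an interval
   lying in an open set of small measure, to which absolute continuity applies. *)
Lemma ac_derive0 a b f : a <= b -> ac a b f ->
  {ae mu, forall t, t \in `[a, b] -> is_derive t (1 : R) f 0} -> f b = f a.
Proof.
move=> ab acf aef.
(* The factor b - a comes from points with derivative 0, at slope [e]; the extra 1 comes from the
   null set, where the total variation is below [e]. *)
suff H e : 0 < e -> `|f b - f a| <= e * (b - a + 1).
  apply/eqP; rewrite -subr_eq0 -normr_le0; apply/ler_addgt0Pl => e e0.
  have ba0 : 0 < b - a + 1 by rewrite ltr_wpDl // subr_ge0.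
  rewrite addr0; apply: le_trans (H (e / (b - a + 1)) _) _; first exact: divr_gt0.
  by rewrite divfK // gt_eqF.
move=> e0; have [d d0 Hd] := acf e e0.
have [A [mA A0 HA]] := aef.
(* Disjoint intervals inside the open set [G], which contains the exceptional set [A], have total
   length below [d], so [Hd] applies to them. *)
have [|G [oG AG mG]] := @lebesgue_regularity_outer R A d mA _ d0.
  by rewrite [X in (X < _)%E](_ : _ = 0%E).
have mmG := open_measurable oG.
have {}mG : (mu G < d%:E)%E.
  rewrite -(setDUK AG) measureU //; last 2 first.
  - exact: measurableD.
  - by rewrite setDE setIC -setIA setICl setI0.
  rewrite -[X in (X < _)%E]/(mu A + mu (G `\` A))%E.
  by rewrite [X in (X + _)%E](_ : _ = 0%E) // add0e.
(* Length budget of the listed intervals: [m] grows by y - t across an interval [t, y] inside [G],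
   and it always stays below [d]. *)
pose m t := fine (mu (G `&` `]a, t])).
have mfin t : mu (G `&` `]a, t]) \is a fin_num.
  rewrite ge0_fin_numE //; apply: le_lt_trans (lt_trans mG (ltry d)).
  by apply: le_measure; rewrite ?inE //; exact: measurableI.
have mle t : m t < d.
  rewrite -lte_fin fineK //; apply: le_lt_trans mG.
  by apply: le_measure; rewrite ?inE //; exact: measurableI.
have mmono t y : t <= y -> m t <= m y.
  move=> ty; rewrite -lee_fin !fineK //.
  apply: le_measure; rewrite ?inE; try exact: measurableI.
  by apply: setIS => s /=; rewrite !in_itv /= => /andP[->] /le_trans ->.
have madd t y : a <= t -> t <= y -> (forall s, t <= s <= y -> G s) ->
    m t + (y - t) <= m y.
  move=> at_ ty tyG.
  have -> : y - t = fine (mu `]t, y]).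
    rewrite lebesgue_measure_itv /= lte_fin.
    by case: ltgtP ty => //= -> _; rewrite subrr.
  rewrite -fineD //; last first.
    by rewrite lebesgue_measure_itv; case: ifP.
  rewrite -measureU //; last 2 first.
  - exact: measurableI.
  - rewrite -subset0 => s /= [[_]]; rewrite !in_itv /= => /andP[_ st].
    by rewrite ltNge st.
  rewrite le_eqVlt; apply/orP; left; apply/eqP; congr (fine (mu _)).
  apply/seteqP; split => s /=; rewrite !in_itv /=.
    move=> [[Gs /andP[as_ st]]|/andP[ts sy]].
      by split => //; rewrite as_ (le_trans st).
    by split; [apply: tyG; rewrite ltW | rewrite (le_lt_trans at_ ts)].
  move=> [Gs /andP[as_ sy]]; have [st|ts] := leP s t; first by left; rewrite as_.
  by right.
(* Invariant of the induction. New intervals are put in front of the list, hence the decreasing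
   order in [pairwise]. *)
pose S t := exists s : seq (R * R),
  [/\ all (fun p => [&& a <= p.1, p.1 <= p.2 & p.2 <= t]) s,
      pairwise (fun p q => q.2 <= p.1) s,
      \sum_(p <- s) (p.2 - p.1) <= m t &
      `|f t - f a| <= e * (t - a) + \sum_(p <- s) `|f p.2 - f p.1|].
have Sslope t y : t <= y -> `|f y - f t| <= e * (y - t) -> S t -> S y.
  move=> ty fyt [s [H1 H2 H3 H4]]; exists s; split => //.
  - apply: sub_all H1 => p /and3P[-> -> /=] /le_trans; exact.
  - exact: le_trans (mmono _ _ ty).
  - have -> : f y - f a = (f y - f t) + (f t - f a) by ring.
    apply: le_trans (ler_normD _ _) _.
    have -> : e * (y - a) = e * (y - t) + e * (t - a) by ring.
    by rewrite -addrA lerD.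
have SG t y : a <= t -> t <= y -> (forall s, t <= s <= y -> G s) -> S t -> S y.
  move=> at_ ty tyG [s [H1 H2 H3 H4]]; exists ((t, y) :: s); split => //=.
  - rewrite at_ ty lexx /=; apply: sub_all H1 => p /and3P[-> -> /=] /le_trans; exact.
  - rewrite H2 andbT; apply: sub_all H1 => p /and3P[_ _]; exact.
  - by rewrite big_cons /= addrC; apply: le_trans (madd _ _ at_ ty tyG); rewrite lerD2r.
  - rewrite big_cons /=.
    have -> : f y - f a = (f y - f t) + (f t - f a) by ring.
    apply: le_trans (ler_normD _ _) _.
    rewrite addrCA lerD2l; apply: le_trans H4 _.
    apply: lerD => //; apply: ler_wpM2l; [exact: ltW | by rewrite lerD2r].
(* The ends t and y must lie on either side of [c]: the derivative at [c] bounds f y - f t only by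
   passing through f c. *)
have local c : a <= c <= b -> exists2 del, 0 < del &
    forall t y, a <= t -> t <= c -> c <= y -> y <= b ->
      c - del < t -> y < c + del -> S t -> S y.
  move=> cab; have [Ac|nAc] := pselect (A c).
    have /nbhs_ballP[del /= del0 Hdel] : nbhs c G by apply: open_nbhs_nbhs; split => //; exact: AG.
    exists del => // t y at_ tc cy yb ct yc; apply: SG => //; first exact: le_trans cy.
    move=> s /andP[ts sy]; apply: Hdel; rewrite /ball /= ltr_distlC.
    by apply/andP; split; [exact: lt_le_trans ts | exact: le_lt_trans yc].
  have dc : is_derive c (1 : R) f 0.
    apply: contrapT => H; apply: nAc; apply: HA => /= H'; apply: H; apply: H'.
    by rewrite in_itv.
  have : \forall z \near c, `|f z - f c| <= e * `|z - c|.
    have [dfc ed] := dc.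
    have := dfc; rewrite /derivable => /cvg_ex [l Hl].
    have l0 : l = 0 by rewrite -ed; apply/esym; exact: cvg_lim Hl.
    move: Hl; rewrite l0 => /cvgrPdist_le /(_ e e0).
    rewrite near_withinE near_simpl => /nbhs_ballP[del /= del0 Hdel].
    apply/nbhs_ballP; exists del => // z zc.
    have [->|zc'] := eqVneq z c; first by rewrite !subrr !normr0 mulr0.
    have zc0 : z - c != 0 by rewrite subr_eq0.
    have zcb : ball 0 del (z - c) by rewrite /ball /= sub0r normrN distrC.
    have := Hdel (z - c) zcb zc0.
    rewrite /= sub0r normrN /GRing.scale /= mulr1 subrK normrM normfV.
    by rewrite ler_pdivrMl ?normr_gt0 // mulrC.
  move=> /nbhs_ballP[del /= del0 Hdel]; exists del => // t y at_ tc cy yb ct yc.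
  apply: Sslope; first exact: le_trans cy.
  have h1 : `|f t - f c| <= e * (c - t).
    rewrite -[c - t]ger0_norm ?subr_ge0 // distrC [`|c - t|]distrC distrC; apply: Hdel.
    by rewrite /ball /= ger0_norm ?subr_ge0 // ltrBlDr addrC -ltrBlDr.
  have h2 : `|f y - f c| <= e * (y - c).
    rewrite -[y - c]ger0_norm ?subr_ge0 //; apply: Hdel.
    by rewrite /ball /= distrC ger0_norm ?subr_ge0 // ltrBlDr addrC.
  have -> : f y - f t = (f y - f c) - (f t - f c) by ring.
  apply: le_trans (ler_normB _ _) _.
  have -> : e * (y - t) = e * (y - c) + e * (c - t) by ring.
  exact: lerD.
have Sa : S a.
  exists [::]; split => //; rewrite big_nil //; last by rewrite !subrr normr0 mulr0 addr0.
  by rewrite fine_ge0.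
pose E := [set t | a <= t <= b /\ S t].
have Ea : E a by split => //; rewrite lexx.
have supE : has_sup E.
  by split; [exists a | exists b => t [/andP[]]].
pose c := sup E.
have ac_ : a <= c by apply: ub_le_sup => //; case: supE.
have cb : c <= b by apply: ge_sup; [exists a | move=> t [/andP[]]].
have [|del del0 Hdel] := local c; first by rewrite ac_ cb.
have [t [/andP[at_ tb] St] ct] := sup_adherent del0 supE.
have tc : t <= c by apply: ub_le_sup; [case: supE | split => //; rewrite at_].
(* This point satisfies [S] and goes beyond the supremum [c] unless c = b. *)
pose y := Num.min b (c + del / 2).
have cy : c <= y by rewrite le_min cb lerDl divr_ge0 ?ltW.
have yb : y <= b by rewrite ge_min lexx.
have Sy : S y.
  apply: (Hdel t) => //.
  by rewrite gt_min ltrD2l ltr_pdivrMr // ltr_pMr // ltr1n orbT.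
have yc : y <= c by apply: ub_le_sup; [case: supE | split => //; rewrite (le_trans ac_ cy)].
have yE : y = b.
  rewrite /y; apply/min_idPl; rewrite leNgt; apply/negP => H.
  move: yc; rewrite /y (min_idPr (ltW H)) leNgt ltrDl => /negP; apply.
  by rewrite divr_gt0.
rewrite yE in Sy; have [s [H1 H2 H3 H4]] := Sy.
have H5 := Hd (size s) (fun k => (nth (0, 0) s k).1) (fun k => (nth (0, 0) s k).2).
have : \sum_(p <- s) `|f p.2 - f p.1| < e.
  rewrite (big_nth (0, 0)) big_mkord; apply: H5.
  - by move=> k; have /allP/(_ _ (mem_nth (0, 0) (ltn_ord k)))/and3P := H1.
  - move=> k k' kk'; have pw := pairwiseP (0, 0) H2.
    have /orP[lt|lt] : ((k < k') || (k' < k))%N by rewrite -neq_ltn.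
      by right; apply: pw => //; rewrite inE.
    by left; apply: pw => //; rewrite inE.
  - apply: le_lt_trans (mle b); apply: le_trans H3.
    by rewrite (big_nth (0, 0)) big_mkord.
move=> H6; apply: le_trans H4 _.
have -> : e * (b - a + 1) = e * (b - a) + e by ring.
by rewrite lerD2l; exact: ltW.
Qed.

(** The difference f - prim h is absolutely continuous with derivative 0 almost everywhere, hence
    constant. The integral form of trajectories, the integral of the exponential and integration by
    parts all rest on this. *)
Lemma ac_prim T f h : 0 <= T -> ac 0 T f -> bmeas h ->
  {ae mu, forall t, t \in `[0, T] -> is_derive t (1 : R) f (h t)} ->
  forall t, 0 <= t <= T -> f t = f 0 + prim h t.
Proof.
move=> T0 acf bh aef t /andP[t0 tT].
have [mh [K hK]] := bh.
have aef' : ac 0 t f.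
  move=> e e0; have [d d0 H] := acf e e0; exists d => // n l r lr.
  by apply: H => k; have [? ? rt] := lr k; split => //; exact: le_trans rt tT.
have : f t - prim h t = f 0 - prim h 0.
  apply: (@ac_derive0 0 t (fun t => f t - prim h t) t0).
    apply: acB => //; apply: (@lipschitz_ac _ _ _ K) => a b /andP[a0 _] /andP[b0 _].
    exact: prim_lip.
  have aeF := ae_filter_ringOfSetsType mu.
  apply: filterS3 (ae_itv_interior 0 t) aef (prim_ae bh) => s s0t dfs dhs st.
  have /andP[s0 _] := s0t st.
  have d1 : is_derive s (1 : R) f (h s).
    by apply: dfs; move: st; rewrite !in_itv /= => /andP[-> /le_trans ->].
  have d2 := dhs s0.
  by rewrite -(subrr (h s)); exact: is_deriveB.
rewrite prim0 subr0 => <-; ring.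
Qed.

End AbsolutelyContinuous.

(** * Row vectors and measurability *)

Section RowVectors.
Context {R : realType}.

Lemma coord_le_norm n (v : 'rV[R]_n) k : `|v ord0 k| <= `|v|.
Proof.
rewrite [leRHS]/Num.Def.normr /= mx_normrE.
exact: (le_bigmax _ (fun i : 'I_1 * 'I_n => `|v i.1 i.2|) (ord0, k)).
Qed.

Lemma norm_le_coord n (v : 'rV[R]_n) c :
  0 <= c -> (forall k, `|v ord0 k| <= c) -> `|v| <= c.
Proof.
move=> c0 vc; rewrite [leLHS]/Num.Def.normr /= mx_normrE.
by apply: bigmax_le => // -[i k] _ /=; rewrite ord1.
Qed.

Lemma coord_le_enorm n (v : 'rV[R]_n) k : `|v ord0 k| <= enorm v.
Proof.
rewrite -sqrtr_sqr /enorm ler_wsqrtr // (bigD1 k) //= lerDl.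
by apply: sumr_ge0 => i _; exact: sqr_ge0.
Qed.

Lemma norm_le_enorm n (v : 'rV[R]_n) : `|v| <= enorm v.
Proof. by apply: norm_le_coord => [|k]; [exact: sqrtr_ge0 | exact: coord_le_enorm]. Qed.

(** The sharp factor is the square root of n; only the equivalence of the two norms is used, so n
    will do. *)
Lemma enorm_le_norm n (v : 'rV[R]_n) : enorm v <= n%:R * `|v|.
Proof.
rewrite -(ger0_norm (mulr_ge0 (ler0n R n) (normr_ge0 v))) -sqrtr_sqr.
apply: ler_wsqrtr; apply: (@le_trans _ _ (n%:R * `|v| ^+ 2)).
  have -> : n%:R * `|v| ^+ 2 = \sum_(k < n) `|v| ^+ 2.
    by rewrite sumr_const card_ord mulr_natl.
  apply: ler_sum => k _; rewrite -(real_normK (num_real (v ord0 k))).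
  by apply: lerXn2r; rewrite ?nnegrE //; exact: coord_le_norm.
rewrite exprMn ler_wpM2r ?sqr_ge0 // -natrX ler_nat.
by case: (n) => // k; rewrite expnS leq_pmulr // expn_gt0.
Qed.

Lemma enorm_ge0 n (v : 'rV[R]_n) : 0 <= enorm v.
Proof. exact: sqrtr_ge0. Qed.

Lemma cvg_coord {T : Type} {F : set_system T} {FF : Filter F} n (y : T -> 'rV[R]_n)
    (v : 'rV[R]_n) :
  (forall k, y i ord0 k @[i --> F] --> v ord0 k) -> y @ F --> v.
Proof.
move=> yv; apply/cvgrPdist_le => e e0.
have H : \forall i \near F, forall k, `|v ord0 k - y i ord0 k| <= e.
  by apply: filter_forall => k; move/cvgrPdist_le: (yv k) => /(_ e e0).
apply: filterS H => i H; apply: norm_le_coord; first exact: ltW.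
by move=> k; rewrite !mxE; exact: H.
Qed.

Lemma pairingB n (p v w : 'rV[R]_n) : pairing p (v - w) = pairing p v - pairing p w.
Proof.
rewrite /pairing -sumrB; apply: eq_bigr => k _; rewrite !mxE; ring.
Qed.

Lemma pairing_le n (p v : 'rV[R]_n) : `|pairing p v| <= n%:R * (`|p| * `|v|).
Proof.
apply: le_trans (ler_norm_sum _ _ _) _.
have -> : n%:R * (`|p| * `|v|) = \sum_(k < n) (`|p| * `|v|).
  by rewrite sumr_const card_ord mulr_natl.
by apply: ler_sum => k _; rewrite normrM ler_pM // coord_le_norm.
Qed.

Lemma pairingZl n c (p v : 'rV[R]_n) : pairing (c *: p) v = c * pairing p v.
Proof. by rewrite /pairing mulr_sumr; apply: eq_bigr => k _; rewrite mxE mulrA. Qed.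

Lemma pairingZr n c (p v : 'rV[R]_n) : pairing p (c *: v) = c * pairing p v.
Proof.
rewrite /pairing mulr_sumr; apply: eq_bigr => k _; rewrite mxE; ring.
Qed.

Lemma cvg_pairing {T : Type} {F : set_system T} {FF : Filter F} n (p v : T -> 'rV[R]_n)
    (p' v' : 'rV[R]_n) :
  (forall k, p i ord0 k @[i --> F] --> p' ord0 k) ->
  (forall k, v i ord0 k @[i --> F] --> v' ord0 k) ->
  pairing (p i) (v i) @[i --> F] --> pairing p' v'.
Proof.
move=> pp vv; apply: (@cvg_big _ _ _ _ _ _ _ F); first exact: add_continuous.
move=> k _; exact: cvgM (pp k) (vv k).
Qed.

End RowVectors.

Section Measurability.
Context {R : realType}.

Definition mvec n (y : R -> 'rV[R]_n) :=
  forall k, measurable_fun setT (fun s => y s ord0 k).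

(** An open set is a countable union of rational boxes, and the preimage of a box is a finite
    intersection of conditions on single coordinates, which [mvec] controls. *)
Lemma mvec_preimage n m (y : R -> 'rV[R]_n) (z : R -> 'rV[R]_m)
    (G : set ('rV[R]_n * 'rV[R]_m)) :
  mvec y -> mvec z -> open G -> measurable [set s | G (y s, z s)].
Proof.
move=> my mz oG.
pose B (i : 'rV[rat]_n * 'rV[rat]_m * rat) := [set v : 'rV[R]_n * 'rV[R]_m |
  (forall k, `|v.1 ord0 k - ratr (i.1.1 ord0 k)| < ratr i.2) /\
  (forall k, `|v.2 ord0 k - ratr (i.1.2 ord0 k)| < ratr i.2)].
(* Enumerates the rational boxes contained in [G]; all other indices contribute the empty set. *)
pose A i := if unpickle i is Some q then
  if pselect (B q `<=` G) then [set s | B q (y s, z s)] else set0 else set0.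
have mB (h : R -> R) q r : measurable_fun setT h ->
    measurable [set s | `|h s - q| < r].
  move=> mh; have m1 : measurable_fun setT (fun s => `|h s - q|).
    by apply: measurableT_comp => //; exact: measurable_funB.
  have -> : [set s | `|h s - q| < r] = (fun s => `|h s - q|) @^-1` `]-oo, r[.
    by apply/seteqP; split => s /=; rewrite in_itv.
  by rewrite -[X in measurable X]setTI; exact: m1.
have -> : [set s | G (y s, z s)] = \bigcup_i A i.
  apply/seteqP; split => s /=; last first.
    move=> [i _]; rewrite /A; case: unpickle => // q; case: pselect => // H; exact: H.
  move=> Gs; have /nbhs_ballP[e /= e0 He] : nbhs (y s, z s) G.
    by apply: open_nbhs_nbhs.
  (* With a box radius below e / 2, every point of the box is within e of the given point, by way of
     the rational centre. *)
  have e2 : 0 < e / 2 by rewrite divr_gt0.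
  have [r /[!inE]/= /itvP hr] := rat_in_itvoo e2.
  have r0 : 0 < ratr r :> R by rewrite hr.
  have Hq (x : R) : {q : rat | `|x - ratr q| < ratr r}.
    apply: cid; have [|q] := @rat_in_itvoo _ (x - ratr r) (x + ratr r).
      by rewrite ltrBlDr -addrA ltrDl addr_gt0.
    by rewrite in_itv /= => hq; exists q; rewrite ltr_distlC.
  pose q := (\row_k sval (Hq (y s ord0 k)), \row_k sval (Hq (z s ord0 k)), r).
  have Bq : B q (y s, z s) by split => k; rewrite /= mxE; exact: (svalP (Hq _)).
  have BG : B q `<=` G.
    move=> v [v1 v2]; apply: He; have hr2 : ratr r + ratr r < e.
      have : ratr r < e / 2 by rewrite hr.
      lra.
    split; rewrite -ball_normE /ball_ /=.
      apply: le_lt_trans hr2; apply: norm_le_coord; first by lra.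
      move=> k; rewrite !mxE.
      have -> : y s ord0 k - v.1 ord0 k = (y s ord0 k - ratr (q.1.1 ord0 k)) -
        (v.1 ord0 k - ratr (q.1.1 ord0 k)) by ring.
      apply: le_trans (ler_normB _ _) _; apply: lerD; apply: ltW; last exact: v1.
      by rewrite /= mxE; exact: (svalP (Hq _)).
    apply: le_lt_trans hr2; apply: norm_le_coord; first by lra.
    move=> k; rewrite !mxE.
    have -> : z s ord0 k - v.2 ord0 k = (z s ord0 k - ratr (q.1.2 ord0 k)) -
      (v.2 ord0 k - ratr (q.1.2 ord0 k)) by ring.
    apply: le_trans (ler_normB _ _) _; apply: lerD; apply: ltW; last exact: v2.
    by rewrite /= mxE; exact: (svalP (Hq _)).
  by exists (pickle q) => //; rewrite /A pickleK; case: pselect.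
apply: bigcupT_measurable => i; rewrite /A; case: unpickle => // q.
case: pselect => //= _.
have -> : [set s | B q (y s, z s)] =
   (\bigcap_(k in [set` 'I_n]) [set s | `|y s ord0 k - ratr (q.1.1 ord0 k)| < ratr q.2])
   `&` (\bigcap_(k in [set` 'I_m]) [set s | `|z s ord0 k - ratr (q.1.2 ord0 k)| < ratr q.2]).
  by apply/seteqP; split => s /= [H1 H2]; split => k //= *; by [apply: H1 | apply: H2].
apply: measurableI.
  by apply: fin_bigcap_measurable => // k _; exact: mB.
by apply: fin_bigcap_measurable => // k _; exact: mB.
Qed.

Lemma measurable_continuous2 n m (f : 'rV[R]_n * 'rV[R]_m -> R) y z :
  continuous f -> mvec y -> mvec z -> measurable_fun setT (fun s => f (y s, z s)).
Proof.
move=> cf my mz _ ; apply: (measurability _ (RGenOInfty.measurableE R)) => //.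
move=> _ [_ [a ->] <-]; rewrite setTI.
apply: (mvec_preimage (G := f @^-1` `]a, +oo[)) => //.
by apply: open_comp => // v _; exact: cf.
Qed.

End Measurability.

(** * Picard iteration *)

Section Picard.
Context {R : realType}.
Local Notation mu := (@lebesgue_measure R).

(** Subtracting the tail bound 2 c 2^-n makes the sequence nondecreasing, adding it makes it
    nonincreasing; the limit and its error bound follow together. *)
Lemma cvg_geometric_increments (u : nat -> R) c :
  (forall n, `|u n.+1 - u n| <= c * 2^-1 ^+ n) ->
  exists2 l, u @ \oo --> l & forall n, `|l - u n| <= 2 * c * 2^-1 ^+ n.
Proof.
move=> uc; pose w n := u n - 2 * c * 2^-1 ^+ n; pose v n := u n + 2 * c * 2^-1 ^+ n.
have half n : 2 * c * 2^-1 ^+ n.+1 = c * 2^-1 ^+ n :> R.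
  by rewrite exprS; field.
have wS : nondecreasing_seq w.
  apply/nondecreasing_seqP => n; rewrite /w half.
  have := uc n; rewrite ler_norml => /andP[+ _]; lra.
have vS : nonincreasing_seq v.
  apply/nonincreasing_seqP => n; rewrite /v half.
  have := uc n; rewrite ler_norml => /andP[_]; lra.
have c0 : 0 <= c by have := le_trans (normr_ge0 _) (uc 0%N); rewrite expr0 mulr1.
have g0 n : 0 <= 2 * c * 2^-1 ^+ n by rewrite mulr_ge0 ?mulr_ge0 ?exprn_ge0 ?invr_ge0.
have wv n m : w n <= v m.
  have [nm|mn] := leP n m.
    by apply: le_trans (wS _ _ nm) _; rewrite /w /v; have := g0 m; lra.
  by apply: le_trans (vS _ _ (ltnW mn)); rewrite /w /v; have := g0 n; lra.
have ubw : has_ubound (range w) by exists (v 0%N) => _ [n _ <-].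
have cw := nondecreasing_is_cvgn wS ubw.
exists (limn w).
  have -> : u = (fun n => w n + geometric (2 * c) (2^-1) n).
    by apply/funext => n; rewrite /w /geometric /=; ring.
  rewrite -[X in _ --> X]addr0; apply: cvgD => //.
  by apply: cvg_geometric; rewrite ger0_norm ?invr_ge0 // invf_lt1 ?ltr1n.
move=> n; rewrite ler_distl; apply/andP; split.
  exact: (nondecreasing_cvgn_le wS cw n).
by apply: limr_le => //; apply: nearW => m; exact: wv.
Qed.

Definition bvec n (y : R -> 'rV[R]_n) := forall k, bmeas (fun s => y s ord0 k).

Lemma bvec_mvec n (y : R -> 'rV[R]_n) : bvec y -> mvec y.
Proof. by move=> by_ k; have [] := by_ k. Qed.

Lemma bvec_bounded n (y : R -> 'rV[R]_n) : bvec y -> exists K, forall s, `|y s| <= K.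
Proof.
move=> by_; have /choice[K HK] : forall k, exists K, forall s, `|y s ord0 k| <= K.
  by move=> k; have [_] := by_ k.
have HK0 k : 0 <= K k by exact: le_trans (HK k 0).
exists (\sum_k K k) => s; apply: norm_le_coord; first exact: sumr_ge0.
move=> k; apply: le_trans (HK k s) _; rewrite (bigD1 k) //= lerDl.
exact: sumr_ge0.
Qed.

Lemma mvec_bvec n (y : R -> 'rV[R]_n) K : mvec y -> (forall s, `|y s| <= K) -> bvec y.
Proof.
move=> my yK k; split; first exact: my.
by exists K => s; apply: le_trans (coord_le_norm _ _) _.
Qed.

(* Iterating from an approximate solution y0 with defect a * W, rather than from
   a constant, gives the stability estimate together with existence. *)
Lemma picard n (f : R -> 'rV[R]_n -> 'rV[R]_n) L (I : (R -> R) -> R -> R) (W : R -> R)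
    (x0 : 'rV[R]_n) (y0 : R -> 'rV[R]_n) a :
  0 <= L ->
  (forall s v w, `|f s v - f s w| <= L * `|v - w|) ->
  (forall y, bvec y -> bvec (fun s => f s (y s))) ->
  (forall h, bmeas h -> bmeas (I h)) ->
  (forall h1 h2 c, bmeas h1 -> bmeas h2 -> 0 <= c ->
     (forall s, `|h1 s - h2 s| <= L * c * W s) ->
     forall t, `|I h1 t - I h2 t| <= c * 2^-1 * W t) ->
  (forall s, 0 <= W s) -> (exists B, forall s, W s <= B) ->
  let Phi y := fun t => x0 + \row_k I (fun s => f s (y s) ord0 k) t in
  bvec y0 -> 0 <= a -> (forall t, `|Phi y0 t - y0 t| <= a * W t) ->
  exists x, [/\ bvec x, forall t, x t = Phi x t & forall t, `|x t - y0 t| <= 2 * a * W t].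
Proof.
move=> L0 Lf bf bI cI W0 [B WB] Phi by0 a0 def.
have bPhi y : bvec y -> bvec (Phi y).
  move=> by_ k; under eq_fun do rewrite /Phi !mxE.
  by apply: bmeasD; [exact: bmeas_cst | apply: bI; exact: bf].
have cPhi y1 y2 c : bvec y1 -> bvec y2 -> 0 <= c ->
    (forall t, `|y1 t - y2 t| <= c * W t) ->
    forall t, `|Phi y1 t - Phi y2 t| <= c * 2^-1 * W t.
  move=> b1 b2 c0 H t; apply: norm_le_coord.
    by rewrite mulr_ge0 // mulr_ge0 ?invr_ge0.
  move=> k; rewrite /Phi !mxE opprD addrACA subrr add0r.
  apply: cI => //; [exact: (bf _ b1) | exact: (bf _ b2) | move=> s].
  have -> : f s (y1 s) ord0 k - f s (y2 s) ord0 k = (f s (y1 s) - f s (y2 s)) ord0 k.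
    by rewrite !mxE.
  apply: le_trans (coord_le_norm _ _) _; apply: le_trans (Lf _ _ _) _.
  by rewrite -mulrA ler_wpM2l.
pose x_ i := iter i Phi y0.
have bx i : bvec (x_ i) by elim: i => //= i; exact: bPhi.
have dx i t : `|x_ i.+1 t - x_ i t| <= a * W t * 2^-1 ^+ i.
  elim: i t => [|i IH] t; first by rewrite expr0 mulr1; exact: def.
  have -> : a * W t * 2^-1 ^+ i.+1 = (a * 2^-1 ^+ i) * 2^-1 * W t by rewrite exprS; ring.
  apply: (cPhi _ _ _ (bx i.+1) (bx i)); first by rewrite mulr_ge0 // exprn_ge0 // invr_ge0.
  by move=> s; apply: le_trans (IH s) _; rewrite mulrAC.
have /choice[x Hx] : forall t, exists v : 'rV[R]_n, forall k,
    (fun i => x_ i t ord0 k) @ \oo --> v ord0 k /\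
    forall i, `|v ord0 k - x_ i t ord0 k| <= 2 * (a * W t) * 2^-1 ^+ i.
  move=> t; have /choice[l Hl] : forall k, exists l,
      (fun i => x_ i t ord0 k) @ \oo --> l /\
      forall i, `|l - x_ i t ord0 k| <= 2 * (a * W t) * 2^-1 ^+ i.
    move=> k; have [|l Hl1 Hl2] := @cvg_geometric_increments (fun i => x_ i t ord0 k) (a * W t).
      move=> i; apply: le_trans (dx i t).
      by apply: le_trans (coord_le_norm _ k); rewrite !mxE.
    by exists l.
  by exists (\row_k l k) => k; rewrite mxE; exact: Hl.
have xx i t : `|x t - x_ i t| <= 2 * (a * W t) * 2^-1 ^+ i.
  apply: norm_le_coord.
    by apply: mulr_ge0; rewrite ?exprn_ge0 ?invr_ge0 // !mulr_ge0.
  by move=> k; rewrite !mxE; have [_] := Hx t k; apply.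
have bx' : bvec x.
  have [K HK] := bvec_bounded by0.
  apply: (@mvec_bvec _ _ (2 * (a * B) + K)).
    move=> k; apply: (@measurable_fun_cvg _ _ _ _ (fun i s => x_ i s ord0 k)).
      by move=> i; have [] := bx i k.
    by move=> s _; have [] := Hx s k.
  move=> s; have -> : x s = (x s - x_ 0%N s) + y0 s by rewrite subrK.
  apply: le_trans (ler_normD _ _) _; apply: lerD; last exact: HK.
  apply: le_trans (xx 0%N s) _; rewrite expr0 mulr1.
  by rewrite ler_wpM2l // ler_wpM2l.
exists x; split => //; last first.
  by move=> t; have := xx 0%N t; rewrite expr0 mulr1 mulrA.
move=> t; apply/eqP; rewrite -subr_eq0 -normr_le0; apply/ler_addgt0Pl => e e0; rewrite addr0.
have c0 i : 0 <= 2 * a * 2^-1 ^+ i :> R by rewrite mulr_ge0 ?mulr_ge0 // exprn_ge0 // invr_ge0.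
(* Since [x_ i.+1] is [Phi (x_ i)], the distance splits into the error of [x_ i.+1] and the image
   under [Phi] of the error of [x_ i]. *)
have H i : `|x t - Phi x t| <= 2 * (2 * a * W t) * 2^-1 ^+ i.
  have -> : x t - Phi x t = (x t - x_ i.+1 t) + (Phi (x_ i) t - Phi x t).
    by rewrite addrA subrK.
  apply: le_trans (ler_normD _ _) _.
  apply: (@le_trans _ _ (2 * a * 2^-1 ^+ i * 2^-1 * W t + 2 * a * 2^-1 ^+ i * 2^-1 * W t)).
    apply: lerD.
      by apply: le_trans (xx i.+1 t) _; rewrite exprS le_eqVlt; apply/orP; left; apply/eqP; ring.
    apply: (cPhi _ _ _ (bx i) bx') => // s; rewrite distrC; apply: le_trans (xx i s) _.
    by rewrite le_eqVlt; apply/orP; left; apply/eqP; ring.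
  have := mulr_ge0 (c0 i) (W0 t); lra.
have : geometric (2 * (2 * a * W t)) (2^-1) @ \oo --> (0 : R).
  by apply: cvg_geometric; rewrite ger0_norm ?invr_ge0 // invf_lt1 ?ltr1n.
move/cvgrPdist_le => /(_ e e0) [i _ /(_ i (leqnn i))] /=.
rewrite sub0r normrN => Hi; apply: le_trans (H i) _.
exact: le_trans (ler_norm _) Hi.
Qed.

End Picard.

(** * Integral equations *)

Section IntegralEquations.
Context {R : realType}.
Local Notation mu := (@lebesgue_measure R).
Implicit Types (T t s K L a b c : R) (h : R -> R).

(** Composition with [clamp] extends a curve beyond [0, T] by its end values, so that a continuous
    one becomes bounded and measurable on the whole line. *)
Definition clamp T t := Num.max 0 (Num.min t T).

Lemma clamp_itv T t : 0 <= T -> 0 <= clamp T t <= T.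
Proof. by move=> T0; rewrite /clamp le_max lexx /= ge_max T0 ge_min lexx orbT. Qed.

Lemma clamp_id T t : 0 <= t <= T -> clamp T t = t.
Proof. by move=> /andP[t0 tT]; rewrite /clamp (min_idPl tT) (max_idPr t0). Qed.

Lemma clampK T t : 0 <= T -> clamp T (clamp T t) = clamp T t.
Proof. by move=> T0; rewrite clamp_id // clamp_itv. Qed.

Lemma clamp_lip T s t : `|clamp T t - clamp T s| <= `|t - s|.
Proof.
rewrite /clamp !maxEle !minEle; apply/ler_normlP; split;
 have := ler_norm (t - s); have := ler_norm (- (t - s)); rewrite normrN;
 do ![case: ifP => //]; move=> *; lra.
Qed.

Lemma bmeas_lipschitz h K L : (forall s t, `|h t - h s| <= L * `|t - s|) ->
  (forall s, `|h s| <= K) -> bmeas h.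
Proof.
move=> hL hK; split; last by exists K.
apply: continuous_measurable_fun => s; apply/cvgrPdist_le => e e0.
have L1 : 0 < `|L| + 1 by rewrite ltr_wpDl.
apply/nbhs_ballP; exists (e / (`|L| + 1)); first exact: divr_gt0.
move=> t; rewrite /ball /= ltr_pdivlMr // => st; apply: le_trans (hL t s) _.
apply: le_trans (ltW st); rewrite mulrC ler_wpM2l //.
by rewrite (le_trans (ler_norm _)) // lerDl.
Qed.

Lemma bmeas_clamp T h L : 0 <= T ->
  (forall s t, 0 <= s <= T -> 0 <= t <= T -> `|h t - h s| <= L * `|t - s|) ->
  bmeas (fun t => h (clamp T t)).
Proof.
move=> T0 hL; have L1 : L <= `|L| by exact: ler_norm.
apply: (@bmeas_lipschitz _ (`|h 0| + `|L| * T) `|L|) => [s t|s].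
  apply: le_trans (hL _ _ (clamp_itv s T0) (clamp_itv t T0)) _.
  apply: le_trans (ler_wpM2r (normr_ge0 _) L1) _.
  by apply: ler_wpM2l => //; exact: clamp_lip.
have /andP[s0 sT] := clamp_itv s T0.
have := hL 0 (clamp T s); rewrite lexx T0 s0 sT subr0 => /(_ isT isT) H.
have -> : h (clamp T s) = h 0 + (h (clamp T s) - h 0) by ring.
apply: le_trans (ler_normD _ _) _; rewrite lerD2l.
apply: le_trans H _; rewrite (ger0_norm s0).
by apply: le_trans (ler_wpM2r s0 L1) _; apply: ler_wpM2l.
Qed.

Lemma bmeas_prim_clamp T h : 0 <= T -> bmeas h -> bmeas (fun t => prim h (clamp T t)).
Proof.
move=> T0 bh; have [_ [K hK]] := bh.
apply: (@bmeas_clamp T (prim h) K) => // s t /andP[s0 _] /andP[t0 _].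
exact: prim_lip.
Qed.

Lemma prim_incr_le h f a b : bmeas h -> bmeas f -> 0 <= a -> a <= b ->
  (forall s, `|h s| <= f s) -> `|prim h b - prim h a| <= prim f b - prim f a.
Proof.
move=> bh bf a0 ab hf; rewrite !prim_itvB //.
have i g : bmeas g -> mu.-integrable `]a, b] (EFin \o g).
  move=> bg; apply: (integrableS _ _ _ (bmeas_integrable a b bg)) => //=.
  exact: subset_itv_oc_cc.
apply: le_trans (le_normr_Rintegral _ (i _ bh)) _ => //.
by apply: le_Rintegral => //; [exact: (i _ (bmeas_abs bh)) | exact: i].
Qed.

Lemma expR_lipschitz a b T : exists K, forall s t, 0 <= s <= T -> 0 <= t <= T ->
  `|expR (a + b * t) - expR (a + b * s)| <= K * `|t - s|.
Proof.
exists (expR (a + `|b| * T) * `|b|) => s t; wlog : s t / a + b * s <= a + b * t.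
  move=> H; have [|/ltW] := leP (a + b * s) (a + b * t); first exact: H.
  by move=> st sT tT; rewrite distrC [`|t - s|]distrC H.
move=> st sT /andP[t0 tT]; rewrite ger0_norm ?subr_ge0 ?ler_expR //.
(* Factor out the larger exponential; what remains has the form 1 - exp(-z), which is at most z. *)
have -> : expR (a + b * t) - expR (a + b * s) =
    expR (a + b * t) * (1 - expR (a + b * s - (a + b * t))).
  by rewrite mulrBr mulr1 -expRD; congr (_ - expR _); ring.
rewrite -mulrA; apply: ler_pM.
- exact: expR_ge0.
- by rewrite subr_ge0 -[leRHS]expR0 ler_expR subr_le0.
- rewrite ler_expR lerD2l; apply: le_trans (ler_norm _) _.
  by rewrite normrM (ger0_norm t0) ler_wpM2l.
- have := expR_ge1Dx (a + b * s - (a + b * t)).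
  have := ler_norm (b * (t - s)); rewrite normrM; lra.
Qed.

Lemma bmeas_expR T a b : 0 <= T -> bmeas (fun s => expR (a + b * clamp T s)).
Proof.
move=> T0; have [K HK] := expR_lipschitz a b T.
exact: (@bmeas_clamp T (fun s => expR (a + b * s)) K).
Qed.

Lemma prim_expR T a b t : b != 0 -> 0 <= t <= T ->
  prim (fun s => expR (a + b * clamp T s)) t = (expR (a + b * t) - expR a) / b.
Proof.
move=> b0 /[dup] tT' /andP[t0 tT]; have T0 := le_trans t0 tT.
have [K HK] := expR_lipschitz a b T.
have := @ac_prim R T (fun s => expR (a + b * s) / b)
  (fun s => expR (a + b * clamp T s)) T0.
move=> /(_ _ (bmeas_expR a b T0) _ t tT') H.
rewrite mulrBl.
have {}H : expR (a + b * t) / b = expR (a + b * 0) / b +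
    prim (fun s => expR (a + b * clamp T s)) t.
  apply: H.
    apply: (@lipschitz_ac _ _ _ _ (K / `|b|)) => s u sT uT.
  rewrite -mulrBl normrM normfV mulrAC ler_wpM2r ?invr_ge0 //.
  exact: HK.
  apply: aeW => s; rewrite in_itv /= => sT; rewrite clamp_id //.
  have : is_derive s (1 : R) (fun s => expR (a + b * s) / b) (expR (a + b * s) * b / b).
    by apply: is_derive_eq; rewrite /GRing.scale /=; ring.
  by rewrite mulfK.
by rewrite H mulr0 addr0; ring.
Qed.

(** The weight exp(2 L t) has integral at most exp(2 L t) / (2 L), so an [L]-Lipschitz right-hand
    side contracts by 1/2 on all of [0, T], however long. *)
Lemma forward_contraction T L h1 h2 c t : 0 <= T -> 0 < L -> bmeas h1 -> bmeas h2 -> 0 <= c ->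
  (forall s, `|h1 s - h2 s| <= L * c * expR (0 + 2 * L * clamp T s)) ->
  `|prim h1 (clamp T t) - prim h2 (clamp T t)| <= c * 2^-1 * expR (0 + 2 * L * clamp T t).
Proof.
move=> T0 L0 b1 b2 c0 H; have tT' := clamp_itv t T0; have /andP[t0 tT] := tT'.
have bE := bmeas_expR 0 (2 * L) T0.
have L20 : 2 * L != 0 by rewrite mulf_neq0 ?gt_eqF.
rewrite -primB //.
have := prim_incr_le (bmeasB b1 b2) (bmeasM (bmeas_cst (L * c)) bE) (lexx 0) t0 H.
rewrite !prim0 !subr0 primZ // prim_expR // => /le_trans; apply.
have -> : L * c * ((expR (0 + 2 * L * clamp T t) - expR 0) / (2 * L)) =
  c * 2^-1 * (expR (0 + 2 * L * clamp T t) - expR 0) by field; rewrite gt_eqF.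
rewrite ler_wpM2l ?mulr_ge0 ?invr_ge0 //; have := expR_ge0 (0 : R); lra.
Qed.

(** For integration from t up to T the weight is reversed into exp(2 L (T - t)). *)
Lemma backward_contraction T L h1 h2 c t : 0 <= T -> 0 < L -> bmeas h1 -> bmeas h2 -> 0 <= c ->
  (forall s, `|h1 s - h2 s| <= L * c * expR (2 * L * T + - (2 * L) * clamp T s)) ->
  `|(prim h1 T - prim h1 (clamp T t)) - (prim h2 T - prim h2 (clamp T t))|
    <= c * 2^-1 * expR (2 * L * T + - (2 * L) * clamp T t).
Proof.
move=> T0 L0 b1 b2 c0 H; have tT' := clamp_itv t T0; have /andP[t0 tT] := tT'.
have bE := bmeas_expR (2 * L * T) (- (2 * L)) T0.
have L20 : - (2 * L) != 0 by rewrite oppr_eq0 mulf_neq0 ?gt_eqF.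
have := prim_incr_le (bmeasB b1 b2) (bmeasM (bmeas_cst (L * c)) bE) t0 tT H.
rewrite !primB // !primZ // !prim_expR //; last by rewrite T0 lexx.
have -> : forall x y z w : R, x - y - (z - w) = x - z - (y - w) by move=> *; ring.
move=> /le_trans; apply.
have -> : 2 * L * T + - (2 * L) * T = 0 by ring.
rewrite -mulrBr.
set E := expR (_ + _ * clamp T t); set E0 := expR (2 * L * T).
have -> : L * c * ((expR 0 - E0) / - (2 * L) - (E - E0) / - (2 * L)) =
  c * 2^-1 * (E - expR 0) by field; rewrite gt_eqF.
rewrite ler_wpM2l ?mulr_ge0 ?invr_ge0 //; have := expR_ge0 (0 : R); lra.
Qed.

(** A Gronwall estimate: [a] bounds the defect of [y0] in the integral equation, and exp(2 L T) is
    the largest value of the weight. That [y0] is constant beyond [0, T] matches the clamped Picard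
    map. *)
Lemma forward_solution n (f : R -> 'rV[R]_n -> 'rV[R]_n) L T (x0 : 'rV[R]_n) (y0 : R -> 'rV[R]_n) a :
  0 <= T -> 0 < L ->
  (forall s v w, `|f s v - f s w| <= L * `|v - w|) ->
  (forall y, bvec y -> bvec (fun s => f s (y s))) ->
  bvec y0 -> (forall t, y0 (clamp T t) = y0 t) -> 0 <= a ->
  (forall t k, 0 <= t <= T ->
     `|x0 ord0 k + prim (fun s => f s (y0 s) ord0 k) t - y0 t ord0 k| <= a) ->
  exists x, [/\ bvec x,
    forall t k, 0 <= t <= T -> x t ord0 k = x0 ord0 k + prim (fun s => f s (x s) ord0 k) t &
    forall t, `|x t - y0 t| <= 2 * a * expR (2 * L * T)].
Proof.
move=> T0 L0 Lf bf by0 y0c a0 def.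
have L2 : 0 <= 2 * L by rewrite mulr_ge0 // ltW.
have W1 t : 1 <= expR (0 + 2 * L * clamp T t).
  rewrite -[leLHS]expR0 ler_expR add0r mulr_ge0 //.
  by have /andP[] := clamp_itv t T0.
have WB t : expR (0 + 2 * L * clamp T t) <= expR (2 * L * T).
  rewrite ler_expR add0r ler_wpM2l //.
  by have /andP[] := clamp_itv t T0.
have [|||||||x [bx Hx1 Hx2]] := @picard R n f L (fun h t => prim h (clamp T t))
  (fun t => expR (0 + 2 * L * clamp T t)) x0 y0 a (ltW L0) Lf bf.
- by move=> h; exact: bmeas_prim_clamp.
- by move=> h1 h2 c b1 b2 c0 H t; exact: forward_contraction.
- by move=> s; exact: expR_ge0.
- by exists (expR (2 * L * T)).
- exact: by0.
- exact: a0.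
- move=> t; apply: (@le_trans _ _ a); last by rewrite ler_peMr.
  apply: norm_le_coord => // k; rewrite !mxE -y0c; apply: def.
  exact: clamp_itv.
exists x; split => //.
  by move=> t k tT; rewrite {1}Hx1 !mxE clamp_id.
by move=> t; apply: le_trans (Hx2 t) _; rewrite ler_wpM2l // mulr_ge0.
Qed.

(** Existence with a prescribed value at T, as the adjoint equation requires. The iteration starts
    from 0, whose defect has some bound [B]; the distance estimate is discarded. *)
Lemma backward_solution n (f : R -> 'rV[R]_n -> 'rV[R]_n) L T (xT : 'rV[R]_n) :
  0 <= T -> 0 < L ->
  (forall s v w, `|f s v - f s w| <= L * `|v - w|) ->
  (forall y, bvec y -> bvec (fun s => f s (y s))) ->
  exists x, bvec x /\
    forall t k, 0 <= t <= T -> x t ord0 k = xT ord0 k +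
      (prim (fun s => f s (x s) ord0 k) T - prim (fun s => f s (x s) ord0 k) t).
Proof.
move=> T0 L0 Lf bf.
have L2 : 0 <= 2 * L by rewrite mulr_ge0 // ltW.
have W1 t : 1 <= expR (2 * L * T + - (2 * L) * clamp T t).
  rewrite -[leLHS]expR0 ler_expR mulNr -mulrBr mulr_ge0 // subr_ge0.
  by have /andP[] := clamp_itv t T0.
have WB t : expR (2 * L * T + - (2 * L) * clamp T t) <= expR (2 * L * T).
  rewrite ler_expR gerDl mulNr oppr_le0 mulr_ge0 //.
  by have /andP[] := clamp_itv t T0.
pose I h t := prim h T - prim h (clamp T t).
have bI h : bmeas h -> bmeas (I h).
  by move=> bh; apply: bmeasB; [exact: bmeas_cst | exact: bmeas_prim_clamp].
have b0 : bvec (fun _ : R => 0 : 'rV[R]_n) by move=> k; exact: bmeas_cst.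
have bPhi : bvec (fun t => xT + \row_k I (fun s => f s 0 ord0 k) t).
  move=> k; under eq_fun do rewrite !mxE.
  by apply: bmeasD; [exact: bmeas_cst | apply: bI; exact: (bf _ b0)].
have [B HB] := bvec_bounded bPhi.
have B0 : 0 <= B by exact: le_trans (HB 0).
have [|||||||x [bx Hx1 Hx2]] := @picard R n f L I
  (fun t => expR (2 * L * T + - (2 * L) * clamp T t)) xT (fun=> 0) B (ltW L0) Lf bf.
- by move=> h; exact: bI.
- by move=> h1 h2 c b1 b2 c0 H t; exact: backward_contraction.
- by move=> s; exact: expR_ge0.
- by exists (expR (2 * L * T)).
- exact: b0.
- exact: B0.
- by move=> t; rewrite subr0; apply: le_trans (HB t) _; rewrite ler_peMr.
exists x; split => // t k tT.
by rewrite {1}Hx1 !mxE /I clamp_id.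
Qed.

Lemma is_derive_row n (x : R -> 'rV[R]_n) (v : 'rV[R]_n) t :
  (forall k, is_derive t (1 : R) (fun s => x s ord0 k) (v ord0 k)) ->
  is_derive t (1 : R) x v.
Proof.
move=> H; have dx : derivable x t 1.
  by apply/derivable_mxP => i k; rewrite (ord1 i); have [] := H k.
apply: DeriveDef => //; rewrite derive_mx //; apply/rowP => k; rewrite mxE.
by have [] := H k.
Qed.

Lemma is_derive_coord n (x : R -> 'rV[R]_n) (v : 'rV[R]_n) t k :
  is_derive t (1 : R) x v -> is_derive t (1 : R) (fun s => x s ord0 k) (v ord0 k).
Proof.
move=> [dx <-]; rewrite derive_mx // mxE; apply: derivableP.
by move/derivable_mxP : dx.
Qed.

Lemma ae_forall (J : finType) (P : J -> R -> Prop) :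
  (forall j, {ae mu, forall t, P j t}) -> {ae mu, forall t, forall j, P j t}.
Proof.
move=> H; have aeF := ae_filter_ringOfSetsType mu.
exact: filter_forall.
Qed.

Lemma trajectory_prim n T (x h : R -> 'rV[R]_n) : 0 <= T ->
  abs_continuous 0 T x -> bvec h ->
  {ae mu, forall t, t \in `[0, T] -> is_derive t (1 : R) x (h t)} ->
  forall t k, 0 <= t <= T -> x t ord0 k = x 0 ord0 k + prim (fun s => h s ord0 k) t.
Proof.
move=> T0 acx bh aex t k tT.
apply: (@ac_prim _ T (fun s => x s ord0 k) (fun s => h s ord0 k)) => //.
  move=> e e0; have [d d0 H] := acx e e0; exists d => // K l r lr nov sd.
  apply: le_lt_trans (H K l r lr nov sd); apply: ler_sum => i _.
  by apply: le_trans (coord_le_enorm _ k); rewrite !mxE.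
have aeF := ae_filter_ringOfSetsType mu.
by apply: filterS aex => s H sT; apply: is_derive_coord; exact: H.
Qed.

Lemma prim_ae_derive T (x h : R -> R) c : bmeas h ->
  (forall t, 0 <= t <= T -> x t = c + prim h t) ->
  {ae mu, forall t, t \in `[0, T] -> is_derive t (1 : R) x (h t)}.
Proof.
move=> bh xh; have aeF := ae_filter_ringOfSetsType mu.
apply: filterS2 (ae_itv_interior 0 T) (prim_ae bh) => t t0T H tT'.
have /andP[t0 tT] := t0T tT'.
have : is_derive t (1 : R) (fun s => c + prim h s) (h t).
  have d := H t0.
  by rewrite -[X in is_derive _ _ _ X]add0r; apply: is_deriveD.
apply: near_eq_is_derive.
have : \forall s \near t, s \in `]0, T[ by apply: near_in_itvoo; rewrite in_itv /= t0.
apply: filterS => s; rewrite in_itv /= => /andP[s0 sT].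
by rewrite xh // !ltW.
Qed.

Lemma primN h t : bmeas h -> prim (fun s => - h s) t = - prim h t.
Proof.
by move=> bh; rewrite -mulN1r -primZ //; apply: eq_prim => s _; rewrite mulN1r.
Qed.

(** Integration by parts: the product of two Lipschitz primitives is absolutely continuous, and the
    Leibniz rule holds almost everywhere. *)
Lemma prim_mul T (f1 f2 h1 h2 : R -> R) c1 c2 : 0 <= T ->
  bmeas f1 -> bmeas f2 -> bmeas h1 -> bmeas h2 ->
  (forall t, 0 <= t <= T -> f1 t = c1 + prim h1 t) ->
  (forall t, 0 <= t <= T -> f2 t = c2 + prim h2 t) ->
  f1 T * f2 T = c1 * c2 + prim (fun s => h1 s * f2 s + f1 s * h2 s) T.
Proof.
move=> T0 b1 b2 bh1 bh2 H1 H2; have T0T : 0 <= T <= T by rewrite T0 lexx.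
have [_ [B1 HB1]] := b1; have [_ [B2 HB2]] := b2.
have [_ [K1 HK1]] := bh1; have [_ [K2 HK2]] := bh2.
have lip f h c K s t : bmeas h -> (forall s, `|h s| <= K) ->
    (forall t, 0 <= t <= T -> f t = c + prim h t) ->
    0 <= s <= T -> 0 <= t <= T -> `|f t - f s| <= K * `|t - s|.
  move=> bh hK fh sT tT; rewrite !fh // opprD addrACA subrr add0r.
  by case/andP: sT => ? _; case/andP: tT => ? _; exact: prim_lip.
have := @ac_prim R T (fun t => f1 t * f2 t) (fun s => h1 s * f2 s + f1 s * h2 s) T0.
have bh : bmeas (fun s => h1 s * f2 s + f1 s * h2 s).
  by apply: bmeasD; apply: bmeasM.
have E0 : f1 0 * f2 0 = c1 * c2.
  by rewrite H1 ?H2 ?lexx // !prim0 !addr0.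
rewrite -E0 => H; apply: H => //.
  apply: (@lipschitz_ac _ _ _ _ (K1 * B2 + B1 * K2)) => s t sT tT.
  have -> : f1 t * f2 t - f1 s * f2 s = (f1 t - f1 s) * f2 t + f1 s * (f2 t - f2 s) by ring.
  apply: le_trans (ler_normD _ _) _; rewrite !normrM mulrDl; apply: lerD.
    by rewrite mulrAC; apply: ler_pM => //; exact: (lip f1 h1 c1).
  by rewrite -mulrA; apply: ler_pM => //; exact: (lip f2 h2 c2).
have aeF := ae_filter_ringOfSetsType mu.
apply: filterS2 (prim_ae_derive bh1 H1) (prim_ae_derive bh2 H2) => t d1 d2 tT.
have {}d1 := d1 tT; have {}d2 := d2 tT.
have -> : h1 t * f2 t + f1 t * h2 t = f1 t *: h2 t + f2 t *: h1 t.
  by rewrite /GRing.scale /=; ring.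
exact: (is_deriveM d1 d2).
Qed.

(** Converse of [trajectory_prim]: a primitive of a bounded function is Lipschitz, and Lebesgue
    differentiation recovers the derivative. *)
Lemma prim_trajectory n T (x h : R -> 'rV[R]_n) (c : 'rV[R]_n) : bvec h ->
  (forall t k, 0 <= t <= T -> x t ord0 k = c ord0 k + prim (fun s => h s ord0 k) t) ->
  abs_continuous 0 T x /\
  {ae mu, forall t, t \in `[0, T] -> is_derive t (1 : R) x (h t)}.
Proof.
move=> bh xh; split.
  have [K HK] := bvec_bounded bh.
  have K0 : 0 <= K by exact: le_trans (HK 0).
  move=> e e0.
  have n1 : 0 < n%:R * K + 1 by rewrite ltr_wpDl // mulr_ge0.
  exists (e / (n%:R * K + 1)); first exact: divr_gt0.
  move=> N l r lr _; rewrite ltr_pdivlMr // => H; apply: le_lt_trans H.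
  rewrite mulr_suml; apply: ler_sum => i _; have [l0 lr_ rT] := lr i.
  apply: le_trans (enorm_le_norm _) _.
  apply: (@le_trans _ _ (n%:R * (K * (r i - l i)))).
    rewrite ler_wpM2l //; apply: norm_le_coord; first by rewrite mulr_ge0 // subr_ge0.
    move=> k; rewrite !mxE !xh ?l0 ?rT ?(le_trans l0) ?(le_trans lr_) //.
    have -> : forall x y z : R, x + y - (x + z) = y - z by move=> *; ring.
    rewrite -[r i - l i]ger0_norm ?subr_ge0 //; apply: prim_lip => //.
      by move=> s; apply: le_trans (coord_le_norm _ _) _.
    exact: le_trans lr_.
  rewrite mulrA [leRHS]mulrC ler_wpM2r ?subr_ge0 //; lra.
have aeF := ae_filter_ringOfSetsType mu.
have := ae_forall (fun k => prim_ae_derive (bh k) (xh^~ k)).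
by apply: filterS => t H tT; apply: is_derive_row => k; exact: H.
Qed.

End IntegralEquations.

(** * A theorem of the alternative *)

Section Multipliers.
Context {R : realType} (n : nat).
Implicit Types (G D : set 'rV[R]_n).

Lemma continuous_pairing (a : 'rV[R]_n) : continuous (pairing a).
Proof.
apply: continuous_big => [|k _ v]; first exact: add_continuous.
apply: (@continuousM _ _ (fun=> a ord0 k) (fun w : 'rV[R]_n => w ord0 k)).
  exact: cst_continuous.
exact: coord_continuous.
Qed.

Lemma pairing_convex (a x y : 'rV[R]_n) t :
  pairing a (x + t *: (y - x)) = pairing a x + t * (pairing a y - pairing a x).
Proof.
rewrite -pairingB -pairingZr /pairing -big_split /=.
by apply: eq_bigr => k _; rewrite !mxE; ring.
Qed.

Definition convex_set G := forall x y t, G x -> G y -> 0 <= t <= 1 -> G (x + t *: (y - x)).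

(* Minimize the penalty \sum_k max(0, <a_k, x>)^2 over G; if the minimum x is
   not 0, the weights c_k = max(0, <a_k, x>) violate the hypothesis. *)
Lemma finite_alternative G K (a : 'I_K -> 'rV[R]_n) :
  compact G -> G !=set0 -> convex_set G ->
  (forall (c : 'I_K -> R) del, (forall k, 0 <= c k) -> 0 < del ->
     ~ (forall x, G x -> del <= \sum_k c k * pairing (a k) x)) ->
  exists2 x, G x & forall k, pairing (a k) x <= 0.
Proof.
move=> cG G0 convG alt.
pose Phi (x : 'rV[R]_n) := \sum_k (Num.max 0 (pairing (a k) x)) ^+ 2.
have cPhi : continuous Phi.
  apply: continuous_big => [|k _ v]; first exact: add_continuous.
  have H : {for v, continuous (fun x => Num.max 0 (pairing (a k) x))}.
    apply: (@continuous_max _ _ (fun=> 0) (pairing (a k))).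
      exact: cst_continuous.
    exact: continuous_pairing.
  under eq_fun do rewrite expr2.
  exact: (continuousM H H).
have [x] := EVT_min_rV G0 cG (continuous_subspaceT cPhi).
rewrite inE => Gx minx.
pose c k := Num.max 0 (pairing (a k) x).
have c0 k : 0 <= c k by rewrite /c le_max lexx.
have [c_eq0|] := pselect (forall k, c k = 0).
  by exists x => // k; rewrite -(c_eq0 k) /c le_max lexx orbT.
move=> nc0; exfalso; have del0 : 0 < \sum_k c k ^+ 2.
  rewrite lt_neqAle sumr_ge0 ?andbT; last by move=> *; exact: sqr_ge0.
  apply/eqP => H; apply: nc0 => k; apply/eqP; rewrite -sqrf_eq0.
  apply/eqP; move/esym/eqP : H; rewrite psumr_eq0 => [|i _]; last exact: sqr_ge0.
  by move/allP => /(_ k); rewrite mem_index_enum => /(_ isT) /eqP.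
apply: (alt c _ c0 del0) => y Gy.
pose e k := pairing (a k) y - pairing (a k) x.
(* Minimality of [x] along the segment towards [y], expanded and divided by [t]. *)
have quad t : 0 < t <= 1 -> 0 <= 2 * (\sum_k c k * e k) + t * \sum_k e k ^+ 2.
  move=> /andP[t0 t1].
  have : Phi x <= \sum_k (c k + t * e k) ^+ 2.
    apply: (@le_trans _ _ (Phi (x + t *: (y - x)))).
      by apply: minx; rewrite inE; apply: convG => //; rewrite (ltW t0).
    (* Termwise max(0, p + q)^2 <= (max(0, p) + q)^2, an upper bound that is quadratic in t and
       avoids differentiating the maximum. *)
    apply: ler_sum => k _; rewrite pairing_convex -/(e k) /c.
    set p := pairing (a k) x; set q := t * e k.
    rewrite !maxEle; case: (leP 0 (p + q)) => h1; case: (leP 0 p) => h2 //.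
    - by rewrite add0r !expr2; nra.
    - by rewrite expr0n /= sqr_ge0.
    - by rewrite expr0n /= sqr_ge0.
  have -> : \sum_k (c k + t * e k) ^+ 2 =
     Phi x + t * (2 * (\sum_k c k * e k) + t * \sum_k e k ^+ 2).
    rewrite !mulr_sumr -big_split /= mulr_sumr -big_split /=.
    by apply: eq_bigr => k _; rewrite /c; ring.
  by rewrite lerDl pmulr_rge0.
have ce : 0 <= \sum_k c k * e k.
  rewrite leNgt; apply/negP => H.
  set A := \sum_k c k * e k in H quad; set B := \sum_k e k ^+ 2 in quad.
  have B0 : 0 <= B by apply: sumr_ge0 => *; exact: sqr_ge0.
  have B1 : 0 < B + 1 - A by lra.
  (* For A < 0 this t lies in (0, 1] and satisfies t B <= -A, so that 2 A + t B <= A < 0. *)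
  have := quad (- A / (B + 1 - A)).
  rewrite divr_gt0 ?oppr_gt0 // ler_pdivrMr // mul1r.
  have -> : (- A <= B + 1 - A) by lra.
  move=> /(_ isT); have : - A / (B + 1 - A) * B <= - A.
    rewrite mulrAC ler_pdivrMr //; nra.
  lra.
(* Here c_k <a_k, x> = c_k^2, because c_k is the positive part of <a_k, x>. *)
have -> : \sum_k c k * pairing (a k) y = \sum_k c k ^+ 2 + \sum_k c k * e k.
  rewrite -big_split /=; apply: eq_bigr => k _; rewrite /e /c maxEle.
  by case: ifP => _; ring.
by rewrite lerDl.
Qed.

Lemma multiplier_exists G D : compact G -> G !=set0 -> convex_set G ->
  (forall K (a : 'I_K -> 'rV[R]_n) (c : 'I_K -> R) del,
     (forall k, D (a k)) -> (forall k, 0 <= c k) -> 0 < del ->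
     ~ (forall x, G x -> del <= \sum_k c k * pairing (a k) x)) ->
  exists2 x, G x & forall a, D a -> pairing a x <= 0.
Proof.
move=> cG G0 convG alt.
(* Over an empty [D] the intersection below is the whole space and would not place the point in
   [G]. *)
have [D0|D0] := pselect (D = set0).
  by have [x Gx] := G0; exists x => // a; rewrite D0.
pose f (a : 'rV[R]_n) := G `&` [set x | pairing a x <= 0].
have [x Hx] : \bigcap_(a in D) f a !=set0.
  move: (cG); rewrite compact_In0; apply.
    exists (fun a => [set x | pairing a x <= 0]) => // a _.
    apply: (@closed_comp _ _ (pairing a) [set z | z <= 0]); last exact: closed_le.
    by move=> v _; exact: continuous_pairing.
  move=> E ED; have [|x Gx Hx] := @finite_alternative G (size (finmap.enum_fset E))
      (fun k => nth 0 (finmap.enum_fset E) k) cG G0 convG.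
    move=> c del c0 del0; apply: alt => // k.
    have kE := mem_nth 0 (ltn_ord k).
    by have := ED _ kE; rewrite inE.
  exists x => a /= aE; split => //=.
  have ia : (index a (finmap.enum_fset E) < (size (finmap.enum_fset E)))%N by rewrite index_mem.
  by have := Hx (Ordinal ia); rewrite /= nth_index.
have [a Da] : D !=set0 by apply/set0P/eqP.
exists x; first by have [] := Hx a Da.
by move=> b Db; have [] := Hx b Db.
Qed.

End Multipliers.

(** * Finite maxima and measurable controls *)

Section Maxima.
Context {R : realType}.

Lemma ord_max_val_ge N (f : 'I_N.+1 -> R) j : f j <= ord_max_val f.
Proof. exact: le_bigmax. Qed.

Lemma ord_max_val_le N (f : 'I_N.+1 -> R) c : (forall j, f j <= c) -> ord_max_val f <= c.
Proof. by move=> fc; apply: bigmax_le. Qed.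

Lemma argmax_exists N (f : 'I_N.+1 -> R) (A : 'I_N.+1 -> Prop) : (exists j, A j) ->
  exists2 j, A j & forall k, A k -> f k <= f j.
Proof.
move=> [j0 Aj0]; have A0 : (fun k => `[< A k >]) j0 by exact/asboolP.
case: (@arg_maxP _ _ _ j0 (fun k => `[< A k >]) f A0) => j /asboolP Aj H.
by exists j => // k Ak; apply: H; exact/asboolP.
Qed.

Lemma argmaxE N (f : 'I_N.+1 -> R) j : argmax f j -> f j = ord_max_val f.
Proof.
move=> fj; apply/eqP; rewrite eq_le ord_max_val_ge /=.
exact: ord_max_val_le.
Qed.

(* One-sided derivative of \sum_i max_j: only the indices active at the limit
   matter, and sigma selects the fastest growing ones among them. *)
Lemma active_selection M N (g0 D : 'I_M -> 'I_N.+1 -> R)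
    (gn : 'I_M -> 'I_N.+1 -> nat -> R) (eps : nat -> R) r :
  (forall n, 0 < eps n) -> eps @ \oo --> 0 -> 0 < r ->
  (forall i j, (fun n => (gn i j n - g0 i j) / eps n) @ \oo --> - (r * D i j)) ->
  (\forall n \near \oo, \sum_(i < M) ord_max_val (g0 i) <=
     \sum_(i < M) ord_max_val (fun j => gn i j n)) ->
  exists sigma : 'I_M -> 'I_N.+1,
    (forall i, argmax (g0 i) (sigma i)) /\ \sum_(i < M) D i (sigma i) <= 0.
Proof.
move=> e0 ecvg r0 gcvg cost.
(* The difference quotient of [gn i j] tends to - r D i j, so the smallest D among the active
   indices grows fastest. *)
have /choice[sigma Hs] : forall i, exists j, argmax (g0 i) j /\
    forall k, argmax (g0 i) k -> D i j <= D i k.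
  move=> i; have [|j Aj Hj] := @argmax_exists _ (fun j => - D i j) (argmax (g0 i)).
    by have [//|j _ Hj] := @argmax_exists _ (g0 i) (fun=> True); [exists ord0|exists j => k; exact: Hj].
  by exists j; split => // k /Hj; rewrite lerN2.
exists sigma; split; first by move=> i; have [] := Hs i.
set S := \sum_(i < M) D i (sigma i).
(* One error [eta] for each i. Dividing by M + 1 rather than M in the choice of [eta] makes the
   contradiction strict and covers M = 0. *)
suff H eta : 0 < eta -> r * S <= M%:R * eta.
  rewrite leNgt; apply/negP => S0.
  have rS : 0 < r * S by exact: mulr_gt0.
  have M1 : 0 < M%:R + 1 :> R by rewrite ltr_wpDl.
  have := H (r * S / (M%:R + 1)); rewrite divr_gt0 // => /(_ isT).
  rewrite mulrA ler_pdivlMr // mulrDr mulr1; lra.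
move=> eta0.
have gn_g0 i j : gn i j @ \oo --> g0 i j.
  have -> : gn i j = (fun n => g0 i j + (gn i j n - g0 i j) / eps n * eps n).
    by apply/funext => n; rewrite divfK ?gt_eqF // addrC subrK.
  rewrite -[X in _ --> X]addr0 -(mulr0 (- (r * D i j))).
  by apply: cvgD; [exact: cvg_cst | exact: cvgM (gcvg i j) ecvg].
have small i j : \forall n \near \oo,
    gn i j n <= ord_max_val (g0 i) + eps n * (- (r * D i (sigma i)) + eta).
  have [Aj|nAj] := pselect (argmax (g0 i) j).
    have /cvgrPdist_le /(_ _ eta0) := gcvg i j.
    apply: filterS => n; rewrite ler_distlC => /andP[_].
    rewrite ler_pdivrMr // -(argmaxE Aj).
    have := (Hs i).2 j Aj; have := e0 n; rewrite -(ler_pM2l r0) => en HD.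
    have : eps n * (r * D i (sigma i)) <= eps n * (r * D i j) by rewrite ler_pM2l.
    lra.
  (* An inactive index starts strictly below the maximum and stays below it, because both its change
     and the correction of order [eps n] tend to 0. *)
  have lt : 0 < ord_max_val (g0 i) - g0 i j.
    rewrite subr_gt0 lt_neqAle ord_max_val_ge andbT; apply/eqP => E.
    by apply: nAj => k; rewrite E; exact: ord_max_val_ge.
  have H : (fun n => gn i j n - eps n * (- (r * D i (sigma i)) + eta)) @ \oo --> g0 i j.
    rewrite -[X in _ --> X]subr0 -(mul0r (- (r * D i (sigma i)) + eta)).
    by apply: cvgB; [exact: gn_g0 | apply: cvgM => //; exact: cvg_cst].
  have /cvgrPdist_le /(_ _ lt) := H.
  by apply: filterS => n; rewrite ler_distlC => /andP[_]; lra.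
have all_small : \forall n \near \oo, forall i j,
    gn i j n <= ord_max_val (g0 i) + eps n * (- (r * D i (sigma i)) + eta).
  by apply: filter_forall => i; apply: filter_forall => j; exact: small.
have [n [Hn Hc]] := filter_ex (filterI all_small cost).
have : \sum_(i < M) ord_max_val (fun j => gn i j n) <=
    \sum_(i < M) (ord_max_val (g0 i) + eps n * (- (r * D i (sigma i)) + eta)).
  by apply: ler_sum => i _; apply: ord_max_val_le => j; exact: Hn.
move/(le_trans Hc); rewrite big_split /= lerDl -mulr_sumr pmulr_rge0 //.
rewrite big_split /= sumr_const card_ord -mulr_natl sumrN -mulr_sumr -/S; lra.
Qed.

End Maxima.

Section Controls.
Context {R : realType}.
Local Notation mu := (@lebesgue_measure R).

Lemma ac_bvec n T (x : R -> 'rV[R]_n) : 0 <= T -> abs_continuous 0 T x ->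
  bvec (fun t => x (clamp T t)).
Proof.
move=> T0 acx k.
pose y t := x (clamp T t) ord0 k.
have cy : continuous y.
  move=> t; apply/cvgrPdist_lt => e e0; have [d d0 H] := acx e e0.
  apply/nbhs_ballP; exists d => // s; rewrite /ball /= => ts.
  wlog : s t ts / clamp T s <= clamp T t.
    move=> H'; have [|/ltW] := leP (clamp T s) (clamp T t); first exact: H'.
    by move=> ?; rewrite distrC; apply: H' => //; rewrite distrC.
  move=> st; have /andP[s0 sT] := clamp_itv s T0; have /andP[t0 tT] := clamp_itv t T0.
  (* Continuity is absolute continuity applied to a single interval. *)
  have := H 1%N (fun=> clamp T s) (fun=> clamp T t).
  rewrite !big_ord1 => H1.
  apply: le_lt_trans (H1 _ _ _) => //.
  - by rewrite /y; apply: le_trans (coord_le_enorm _ k); rewrite !mxE.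
  - by move=> i j; rewrite (ord1 i) (ord1 j) eqxx.
  - by apply: le_lt_trans ts; rewrite -[leLHS]ger0_norm ?subr_ge0 //; exact: clamp_lip.
have cay : continuous (fun t => `|y t|).
  by move=> t; apply: (continuous_comp (cy t)); exact: norm_continuous.
have [c cT Hc] := EVT_max T0 (continuous_subspaceT cay).
split; first exact: continuous_measurable_fun.
exists `|y c| => t; have := Hc (clamp T t).
rewrite in_itv /= clamp_itv // => /(_ isT).
by rewrite /y clampK.
Qed.

Lemma bmeas_pairing n (q y : R -> 'rV[R]_n) : bvec q -> bvec y ->
  bmeas (fun s => pairing (q s) (y s)).
Proof. by move=> bq by_; apply: bmeas_sum => k; exact: bmeasM. Qed.

Lemma bvecB n (q y : R -> 'rV[R]_n) : bvec q -> bvec y -> bvec (fun s => q s - y s).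
Proof.
by move=> bq by_ k; under eq_fun do rewrite !mxE; apply: bmeasB.
Qed.

Lemma bvec_mulmx n m (q : R -> 'rV[R]_n) (A : R -> 'M[R]_(n, m)) : bvec q ->
  (forall k l, bmeas (fun s => A s k l)) -> bvec (fun s => q s *m A s).
Proof.
move=> bq bA l; under eq_fun do rewrite mxE.
by apply: bmeas_sum => k; exact: bmeasM.
Qed.

Variables (d m : nat) (F : 'rV[R]_d -> 'rV[R]_m -> 'rV[R]_d) (U : set 'rV[R]_m).
Hypothesis U_compact : compact U.
Hypothesis F_continuous : continuous (fun z : 'rV[R]_d * 'rV[R]_m => F z.1 z.2).

(** The factor |w| + 1 is bounded on the compact [U], so one constant serves all control values; the
    powers of the dimensions come from changing norms. *)
Lemma uniform_lipschitz C : 0 < C ->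
  (forall x y w, enorm (F x w - F y w) <= C * (enorm w + 1) * enorm (x - y)) ->
  exists2 L, 0 < L & forall w, U w -> forall x y, `|F x w - F y w| <= L * `|x - y|.
Proof.
move=> C0 FC; have [B [_ HB]] := compact_bounded U_compact.
have := HB (`|B| + 1); rewrite (le_lt_trans (ler_norm B)) ?ltrDl // => /(_ isT) {}HB.
have B1 : 0 <= m%:R * (`|B| + 1) by rewrite mulr_ge0 // addr_ge0.
have L0 : 0 <= C * (m%:R * (`|B| + 1) + 1) * d%:R.
  by rewrite !mulr_ge0 ?(ltW C0) // addr_ge0.
exists (C * (m%:R * (`|B| + 1) + 1) * d%:R + 1); first by rewrite ltr_wpDl.
move=> w Uw x y; apply: le_trans (norm_le_enorm _) _; apply: le_trans (FC x y w) _.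
apply: (@le_trans _ _ (C * (m%:R * (`|B| + 1) + 1) * (d%:R * `|x - y|))); last first.
  by rewrite mulrA ler_wpM2r // lerDl.
apply: ler_pM; rewrite ?enorm_ge0 ?enorm_le_norm //.
  by rewrite mulr_ge0 ?(ltW C0) // addr_ge0 // enorm_ge0.
rewrite ler_pM2l // lerD2r; apply: le_trans (enorm_le_norm w) _.
by rewrite ler_wpM2l //; exact: HB.
Qed.

Lemma continuous_coordF k :
  continuous (fun z : 'rV[R]_d * 'rV[R]_m => F z.1 z.2 ord0 k).
Proof.
move=> z; apply: (@continuous_comp _ _ _ (fun z : 'rV[R]_d * 'rV[R]_m => F z.1 z.2)
  (fun v : 'rV[R]_d => v ord0 k)); first exact: F_continuous.
exact: coord_continuous.
Qed.

Variable L : R.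
Hypothesis L_gt0 : 0 < L.
Hypothesis F_lip : forall w, U w -> forall x y, `|F x w - F y w| <= L * `|x - y|.

(** F(0, w) is bounded over the compact [U] by continuity, and the Lipschitz estimate carries the
    bound to all |x| <= B. *)
Lemma F_bounded B : exists K, forall x w, U w -> `|x| <= B -> `|F x w| <= K.
Proof.
have cF0 : {within U, continuous (fun w => F 0 w)}.
  apply: continuous_subspaceT => w.
  apply: (@continuous_comp _ _ _ (fun w => (0 : 'rV[R]_d, w))
    (fun z : 'rV[R]_d * 'rV[R]_m => F z.1 z.2)); last exact: F_continuous.
  apply: (@cvg_pair _ _ _ (nbhs w) (nbhs (0 : 'rV[R]_d)) (nbhs w)) => //.
  exact: cvg_cst.
have [K0 [_ HK]] := compact_bounded (continuous_compact cF0 U_compact).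
have := HK (`|K0| + 1); rewrite (le_lt_trans (ler_norm K0)) ?ltrDl // => /(_ isT) {}HK.
exists (`|K0| + 1 + L * B) => x w Uw xB.
have -> : F x w = F 0 w + (F x w - F 0 w) by rewrite addrC subrK.
apply: le_trans (ler_normD _ _) _; apply: lerD; first by apply: HK; exists w.
apply: le_trans (F_lip Uw _ _) _.
by rewrite subr0 ler_wpM2l // ltW.
Qed.

Lemma bvec_F (y : R -> 'rV[R]_d) (u : R -> 'rV[R]_m) :
  bvec y -> mvec u -> (forall s, U (u s)) -> bvec (fun s => F (y s) (u s)).
Proof.
move=> by_ mu_ Uu; have [B HB] := bvec_bounded by_; have [K HK] := F_bounded B.
apply: (@mvec_bvec _ _ _ K) => [k|s]; last exact: HK.
apply: (@measurable_continuous2 _ _ _ (fun z => F z.1 z.2 ord0 k)) => //.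
  exact: continuous_coordF.
exact: bvec_mvec.
Qed.

(** A representative with values in [U] at every time lets later estimates hold pointwise instead of
    almost everywhere. *)
Lemma control_regularize T (u : R -> 'rV[R]_m) : 0 < T -> control T U u ->
  exists v, [/\ mvec v, forall s, U (v s) &
    {ae mu, forall t, t \in `[0, T] -> u t = v t}].
Proof.
move=> T0 [mu_ _ Uu].
have aeF := ae_filter_ringOfSetsType mu.
(* A filler value for times outside [0, T] or in the exceptional set; [U] is nonempty because [0, T]
   has positive measure. *)
have [w0 Uw0] : U !=set0.
  apply: contrapT => /set0P/negP; rewrite negbK => /eqP U0.
  have [A [mA A0 HA]] := Uu.
  have : (mu `[0%R, T] <= mu A)%E.
    apply: le_measure; rewrite ?inE // => t tT; apply: HA => /= H.
    by have := H tT; rewrite U0.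
  rewrite [leRHS]A0 lebesgue_measure_itv /= lte_fin T0 oppr0 addr0 lee_fin.
  by rewrite leNgt T0.
pose w s := if s \in `[0, T] then u s else w0.
have mw : mvec w.
  move=> k; have -> : (fun s => w s ord0 k) =
      (fun s => if s \in `[0, T] then u s ord0 k else w0 ord0 k).
    by apply/funext => s; rewrite /w; case: ifP.
  have -> : (fun s => if s \in `[0, T] then u s ord0 k else w0 ord0 k) =
      (fun s => w0 ord0 k + ((fun s => u s ord0 k - w0 ord0 k) \_ `[0, T]) s).
    apply/funext => s; rewrite patchE mem_setE; case: ifP => _; last by rewrite addr0.
    by rewrite addrC subrK.
  apply: measurable_funD; first exact: measurable_cst.
  apply/(measurable_restrictT _ _).1 => //.
  have H : measurable_fun `[0%R, T] (fun=> w0 ord0 k : R) by exact: measurable_cst.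
  exact: measurable_funB (mu_ k) H.
(* [U] is closed, so the times at which [w] leaves it form the preimage of an open set. *)
have mUw : measurable_fun setT (fun s => `[< U (w s) >]).
  apply: (measurable_fun_bool true) => /=.
  have -> : (fun s => `[< U (w s) >]) @^-1` [set true] = ~` [set s | (~` U) (w s)].
    by apply/seteqP; split => s /=; rewrite ?notK; move/asboolP.
  rewrite setTI; apply: measurableC.
  have oU : open (~` U) by apply: closed_openC; apply: compact_closed => //; exact: norm_hausdorff.
  have oU2 : open [set z : 'rV[R]_m * 'rV[R]_m | (~` U) z.1].
    by apply: (@open_comp _ _ fst (~` U)) => // z _; exact: cvg_fst.
  exact: (mvec_preimage mw mw oU2).
exists (fun s => if `[< U (w s) >] then w s else w0); split.
- move=> k; have -> : (fun s => (if `[< U (w s) >] then w s else w0) ord0 k) =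
     (fun s => if `[< U (w s) >] then w s ord0 k else w0 ord0 k).
    by apply/funext => s; case: ifP.
  by apply: measurable_fun_ifT => //; exact: mw.
- by move=> s; case: asboolP.
- apply: filterS Uu => t H tT; rewrite /w tT.
  by case: asboolP => // nU; case: nU; exact: H.
Qed.

End Controls.

(** * First-order expansion of the cost *)

Section FirstOrder.
Context {R : realType}.

Lemma differentiable_approx (V W : normedModType R) (f : V -> W) a : differentiable f a ->
  forall eta, 0 < eta -> exists2 rho, 0 < rho &
    forall h, `|h| < rho -> `|f (a + h) - f a - 'd f a h| <= eta * `|h|.
Proof.
move=> df eta eta0; have /eqaddoP /(_ _ eta0) := diff_locally df.
move=> /nbhs_ballP[rho /= rho0 H]; exists rho => // h hr.
have := H h; rewrite -ball_normE /= sub0r normrN => /(_ hr).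
by rewrite /= [a + h]addrC !fctE /= opprD addrA.
Qed.

Lemma diff_jacobian n m (f : 'rV[R]_n -> 'rV[R]_m) a h :
  'd f a h = h *m jacobian f a.
Proof. by rewrite /jacobian mul_rV_lin1. Qed.

Lemma diff_grad n (g : 'rV[R]_n -> R) a h : differentiable g a ->
  'd g a h = pairing (grad g a) h.
Proof.
move=> dg; rewrite {1}(row_sum_delta h) linear_sum /pairing.
by apply: eq_bigr => k _; rewrite mxE deriveE // linearZ /= mulrC.
Qed.

Lemma delta_norm_le n (k : 'I_n) : `|delta_mx ord0 k : 'rV[R]_n| <= 1.
Proof.
apply: norm_le_coord => // l; rewrite mxE /=.
by case: (l == k); rewrite ?normr1 ?normr0.
Qed.

(** Steps 1/(i+1) exhibit each entry as the limit of a sequence, which transfers both measurability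
    and the Lipschitz constant to the Jacobian. *)
Lemma jacobian_quotient_cvg n m (f : 'rV[R]_n -> 'rV[R]_m) a k l :
  differentiable f a ->
  (fun i : nat => (i.+1%:R * (f (a + i.+1%:R^-1 *: delta_mx ord0 k) - f a) ord0 l))
    @ \oo --> jacobian f a k l.
Proof.
move=> df; apply/cvgrPdist_le => eta eta0.
have [rho rho0 H] := differentiable_approx df eta0.
have : (@harmonic R) @ \oo --> (0 : R) by exact: cvg_harmonic.
move/cvgrPdist_lt => /(_ _ rho0); apply: filterS => i.
rewrite /= sub0r normrN => Hi.
set s := i.+1%:R^-1 in Hi *; have s0 : 0 < s by rewrite invr_gt0.
have hs : `|s *: (delta_mx ord0 k : 'rV[R]_n)| <= s.
  by rewrite normrZ gtr0_norm // ger_pMr // delta_norm_le.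
have := H (s *: delta_mx ord0 k); rewrite (le_lt_trans hs); last first.
  by move: Hi; rewrite gtr0_norm.
move=> /(_ isT); rewrite diff_jacobian -scalemxAl -rowE => H1.
have -> : jacobian f a k l - i.+1%:R * (f (a + s *: delta_mx ord0 k) - f a) ord0 l =
  - (i.+1%:R * (f (a + s *: delta_mx ord0 k) - f a - s *: row k (jacobian f a)) ord0 l).
  by rewrite !mxE /s; field; rewrite addrC natr1 pnatr_eq0.
rewrite normrN normrM normr_nat.
rewrite -ler_pdivlMl //.
apply: le_trans (coord_le_norm _ _) _; apply: le_trans H1 _.
by rewrite mulrC ler_wpM2r // ltW.
Qed.

Lemma jacobian_entry_le n m (f : 'rV[R]_n -> 'rV[R]_m) a k l L :
  differentiable f a -> (forall y, `|f y - f a| <= L * `|y - a|) ->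
  `|jacobian f a k l| <= L.
Proof.
move=> df fL; have L0 : 0 <= L.
  have [|] := leP 0 L => // Ln.
  have := le_trans (normr_ge0 _) (fL (a + delta_mx ord0 k)).
  rewrite addrAC subrr add0r pmulr_lge0 ?leNgt ?Ln // normr_gt0.
  by apply/eqP => /matrixP /(_ ord0 k); rewrite !mxE !eqxx => /eqP; rewrite oner_eq0.
have H := jacobian_quotient_cvg (k := k) (l := l) df.
have Hn : (fun i : nat => `|i.+1%:R * (f (a + i.+1%:R^-1 *: delta_mx ord0 k) - f a) ord0 l|)
    @ \oo --> `|jacobian f a k l| by exact: cvg_norm.
rewrite -(cvg_lim (@norm_hausdorff _ _) Hn).
apply: limr_le; first by apply/cvg_ex; eexists; exact: Hn.
apply: nearW => i; rewrite normrM normr_nat -ler_pdivlMl //.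
apply: le_trans (coord_le_norm _ _) _; apply: le_trans (fL _) _.
rewrite addrAC subrr add0r normrZ mulrC ler_wpM2r //.
by rewrite normfV normr_nat ger_pMr ?invr_gt0 // delta_norm_le.
Qed.

Lemma mulmx_norm_le n m (p : 'rV[R]_n) (A : 'M[R]_(n, m)) L : 0 <= L ->
  (forall k l, `|A k l| <= L) -> `|p *m A| <= n%:R * L * `|p|.
Proof.
move=> L0 AL; apply: norm_le_coord; first by rewrite !mulr_ge0.
move=> l; rewrite mxE; apply: le_trans (ler_norm_sum _ _ _) _.
have -> : n%:R * L * `|p| = \sum_(k < n) (`|p| * L).
  by rewrite sumr_const card_ord -[RHS]mulr_natl; ring.
by apply: ler_sum => k _; rewrite normrM ler_pM // coord_le_norm.
Qed.

Lemma pairing_mulmx n m (p : 'rV[R]_m) (v : 'rV[R]_n) (A : 'M[R]_(n, m)) :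
  pairing (p *m A^T) v = pairing p (v *m A).
Proof.
rewrite /pairing; under eq_bigr do rewrite mxE big_distrl /=.
under [RHS]eq_bigr do rewrite mxE big_distrr /=.
rewrite exchange_big /=; apply: eq_bigr => l _; apply: eq_bigr => k _.
by rewrite mxE; ring.
Qed.

End FirstOrder.

(** * Adjoint covectors, perturbed trajectories and the change of the cost *)

Section Expansion.
Context {R : realType} (d m : nat).
Variables (F : 'rV[R]_d -> 'rV[R]_m -> 'rV[R]_d) (U : set 'rV[R]_m) (L T : R).
Hypothesis U_compact : compact U.
Hypothesis F_continuous : continuous (fun z : 'rV[R]_d * 'rV[R]_m => F z.1 z.2).
Hypothesis L_gt0 : 0 < L.
Hypothesis F_lip : forall w, U w -> forall x y, `|F x w - F y w| <= L * `|x - y|.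
Hypothesis F_diff : forall w x, differentiable (fun y => F y w) x.
Hypothesis T_gt0 : 0 < T.

(** Acts on row vectors from the right; its transpose is the [Jac] of the adjoint equation. *)
Definition jac_along (x : R -> 'rV[R]_d) (v : R -> 'rV[R]_m) s : 'M[R]_d :=
  jacobian (fun y => F y (v s)) (x s).

Definition solves (x0 : 'rV[R]_d) (u : R -> 'rV[R]_m) (x : R -> 'rV[R]_d) : Prop :=
  bvec x /\ forall t k, 0 <= t <= T ->
    x t ord0 k = x0 ord0 k + prim (fun s => F (x s) (u s) ord0 k) t.

(** Integral form, based at T, of q' = - q A^T with q(T) = [qT], where A is [jac_along x v]. *)
Definition adjoint_solves (x : R -> 'rV[R]_d) (v : R -> 'rV[R]_m) (qT : 'rV[R]_d)
    (q : R -> 'rV[R]_d) : Prop :=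
  bvec q /\ forall t k, 0 <= t <= T -> q t ord0 k = qT ord0 k +
    (prim (fun s => (q s *m (jac_along x v s)^T) ord0 k) T -
     prim (fun s => (q s *m (jac_along x v s)^T) ord0 k) t).

Lemma jac_along_le x v s k l : U (v s) -> `|jac_along x v s k l| <= L.
Proof.
move=> Uv; apply: jacobian_entry_le; first exact: F_diff.
by move=> y; exact: F_lip.
Qed.

Lemma bmeas_jac_along x v k l : bvec x -> mvec v -> (forall s, U (v s)) ->
  bmeas (fun s => jac_along x v s k l).
Proof.
move=> bx mv Uv.
apply: (@bmeas_cvg R (fun i s => i.+1%:R *
   (F (x s + i.+1%:R^-1 *: delta_mx ord0 k) (v s) - F (x s) (v s)) ord0 l) _ L).
- move=> i; apply: measurable_funM; first exact: measurable_cst.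
  have b1 : bvec (fun s => F (x s + i.+1%:R^-1 *: delta_mx ord0 k) (v s)).
    apply: (@bvec_F _ _ _ F U U_compact F_continuous L L_gt0 F_lip
      (fun s => x s + i.+1%:R^-1 *: delta_mx ord0 k)) => // k'.
    under eq_fun do rewrite mxE.
    by apply: bmeasD => //; exact: bmeas_cst.
  have b2 := bvec_F U_compact F_continuous L_gt0 F_lip bx mv Uv.
  by have [] := bvecB b1 b2 l.
- by move=> s; apply: (jacobian_quotient_cvg (f := fun y => F y (v s))).
- by move=> s; exact: jac_along_le.
Qed.

Lemma bmeas_jac_alongT x v k l : bvec x -> mvec v -> (forall s, U (v s)) ->
  bmeas (fun s => (jac_along x v s)^T k l).
Proof. by move=> bx mv Uv; under eq_fun do rewrite mxE; exact: bmeas_jac_along. Qed.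

Lemma adjoint_exists x v qT : bvec x -> mvec v -> (forall s, U (v s)) ->
  exists q, adjoint_solves x v qT q.
Proof.
move=> bx mv Uv.
(* The transposed Jacobian has operator norm at most d L; the added 1 keeps the constant positive
   when d = 0. *)
have [||q [bq Hq]] := @backward_solution R d (fun s p => p *m (jac_along x v s)^T)
   (d%:R * L + 1) T qT (ltW T_gt0) (ltr_wpDl (mulr_ge0 (ler0n _ _) (ltW L_gt0)) ltr01).
- move=> s p p'; rewrite -mulmxBl.
  apply: le_trans (@mulmx_norm_le _ _ _ _ _ L (ltW L_gt0) _) _.
    by move=> k l; rewrite mxE; exact: jac_along_le.
  by rewrite ler_wpM2r // lerDl.
- by move=> y by_; apply: bvec_mulmx => // k l; exact: bmeas_jac_alongT.
by exists q.
Qed.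

(** The reference trajectory [x] solves the equation for [u] up to the integral of F(x, u) - F(x,
    v), so starting the iteration at [x] yields [y] together with its distance to [x]. *)
Lemma perturbation_exists x0 v x u a : mvec v -> (forall s, U (v s)) -> mvec u ->
  (forall s, U (u s)) -> solves x0 v x -> (forall t, x (clamp T t) = x t) -> 0 <= a ->
  (forall t k, 0 <= t <= T ->
    prim (fun s => `|F (x s) (u s) ord0 k - F (x s) (v s) ord0 k|) t <= a) ->
  exists2 y, solves x0 u y & forall t, `|y t - x t| <= 2 * a * expR (2 * L * T).
Proof.
move=> mv Uv mu_ Uu [bx Hx] xc a0 Ha.
have bF := bvec_F U_compact F_continuous L_gt0 F_lip.
have [||||||y [by_ Hy1 Hy2]] := @forward_solution R d (fun s y => F y (u s)) L T x0 x a
  (ltW T_gt0) L_gt0.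
- by move=> s y z; exact: F_lip.
- by move=> y by_; exact: bF.
- exact: bx.
- exact: xc.
- exact: a0.
- move=> t k tT; rewrite Hx // opprD addrACA subrr add0r.
  have b1 : bmeas (fun s => F (x s) (u s) ord0 k) by exact: (bF x u bx mu_ Uu k).
  have b2 : bmeas (fun s => F (x s) (v s) ord0 k) by exact: (bF x v bx mv Uv k).
  rewrite -primB //; apply: le_trans (Ha t k tT).
  exact: (prim_norm _ (bmeasB b1 b2)).
by exists y.
Qed.

(* The adjoint absorbs the linear part of the dynamics, and the remainder is
   o(eps) by dominated convergence. *)
Lemma duality_expansion x0 v x qT q (u : nat -> R -> 'rV[R]_m) (y : nat -> R -> 'rV[R]_d)
    (eps : nat -> R) kap :
  mvec v -> (forall s, U (v s)) ->
  (forall n, mvec (u n)) -> (forall n s, U (u n s)) ->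
  solves x0 v x -> adjoint_solves x v qT q -> (forall n, solves x0 (u n) (y n)) ->
  (forall n, 0 < eps n) -> eps @ \oo --> 0 -> 0 <= kap ->
  (forall n t, `|y n t - x t| <= kap * eps n) ->
  (forall s, \forall n \near \oo, u n s = v s) ->
  (fun n => (pairing qT (y n T - x T) -
     prim (fun s => pairing (q s) (F (x s) (u n s) - F (x s) (v s))) T) / eps n) @ \oo --> 0.
Proof.
move=> mv Uv mu_ Uu [bx Hx] [bq Hq] sy e0 ecvg kap0 yx uv.
have bF := bvec_F U_compact F_continuous L_gt0 F_lip.
have T0 := ltW T_gt0; have T0T : 0 <= T <= T by rewrite T0 lexx.
have [Bq HBq] := bvec_bounded bq.
have Bq0 : 0 <= Bq := le_trans (normr_ge0 _) (HBq 0).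
pose A := jac_along x v.
have bA : bvec (fun s => q s *m (A s)^T).
  by apply: bvec_mulmx => // k l; exact: bmeas_jac_alongT.
have by_ n : bvec (y n) by have [] := sy n.
(* What is left of the derivative of q . (y n - x) once the control increment is subtracted and the
   adjoint term is moved onto y n - x: the error of replacing F(y, u n) - F(x, u n) by the
   linearization at [v]. *)
pose rho n s := pairing (q s) (F (y n s) (u n s) - F (x s) (u n s) - (y n s - x s) *m A s).
have byx n : bvec (fun s => y n s - x s) by exact: bvecB.
have bdA n : bvec (fun s => (y n s - x s) *m A s).
  by apply: bvec_mulmx => // k l; exact: bmeas_jac_along.
have bxu n : bvec (fun s => F (x s) (u n s)) by exact: bF.
have byu n : bvec (fun s => F (y n s) (u n s)) by exact: bF.
have bxv : bvec (fun s => F (x s) (v s)) by exact: bF.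
have brho n : bmeas (rho n).
  by apply: bmeas_pairing => //; do 2 apply: bvecB => //.
have E n : pairing qT (y n T - x T) -
    prim (fun s => pairing (q s) (F (x s) (u n s) - F (x s) (v s))) T = prim (rho n) T.
  have -> : pairing qT (y n T - x T) = prim (fun s => \sum_(k < d)
     (- (q s *m (A s)^T) ord0 k * (y n s - x s) ord0 k +
      q s ord0 k * (F (y n s) (u n s) - F (x s) (v s)) ord0 k)) T.
    rewrite prim_sum; last first.
      move=> k; apply: bmeasD; apply: bmeasM; try exact: (bq k); try exact: (byx n k).
        exact: (bmeasN (bA k)).
      exact: (bvecB (byu n) bxv k).
    apply: eq_bigr => k _.
    have -> : qT ord0 k = q T ord0 k by rewrite Hq // subrr addr0.
    (* The two constants are values at time 0: [qT] plus the full integral for [q], and 0 for y n -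
       x, since both trajectories start at [x0]. *)
    rewrite (@prim_mul R T (fun s => q s ord0 k) (fun s => (y n s - x s) ord0 k)
       (fun s => - (q s *m (A s)^T) ord0 k) (fun s => (F (y n s) (u n s) - F (x s) (v s)) ord0 k)
       (qT ord0 k + prim (fun s => (q s *m (A s)^T) ord0 k) T) 0) //.
    - by rewrite mulr0 add0r.
    - exact: (byx n k).
    - exact: (bmeasN (bA k)).
    - exact: (bvecB (byu n) bxv k).
    - by move=> t tT; rewrite Hq // (primN _ (bA k)) addrA.
    - move=> t tT; have [_ Hy] := sy n; rewrite !mxE Hy // Hx // add0r.
      have -> : prim (fun s => (F (y n s) (u n s) - F (x s) (v s)) ord0 k) t =
          prim (fun s => F (y n s) (u n s) ord0 k) t - prim (fun s => F (x s) (v s) ord0 k) t.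
        rewrite -(primB _ (byu n k) (bxv k)).
        by apply: eq_prim => s _; rewrite !mxE.
      ring.
  rewrite -primB.
  - apply: eq_prim => s _; rewrite /rho /pairing.
    have : \sum_(k < d) (q s *m (A s)^T) ord0 k * (y n s - x s) ord0 k =
      \sum_(k < d) q s ord0 k * ((y n s - x s) *m A s) ord0 k.
      exact: pairing_mulmx.
    move=> H; rewrite big_split /=; under eq_bigr do rewrite mulNr.
    rewrite sumrN H -sumrN -!big_split /= -sumrB; apply: eq_bigr => k _.
    rewrite !mxE; ring.
  - apply: bmeas_sum => k; apply: bmeasD; apply: bmeasM; try exact: (bq k); try exact: (byx n k).
      exact: (bmeasN (bA k)).
    exact: (bvecB (byu n) bxv k).
  - by apply: bmeas_pairing => //; exact: bvecB.
under eq_fun do rewrite E.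
have -> : (fun n => prim (rho n) T / eps n) = (fun n => prim (fun s => (eps n)^-1 * rho n s) T).
  by apply/funext => n; rewrite primZ // mulrC.
have -> : (0 : R) = prim (fun=> 0) T by rewrite prim_cst // mul0r.
have rho_le n s : `|rho n s| <= d%:R * (Bq * `|F (y n s) (u n s) - F (x s) (u n s) - (y n s - x s) *m A s|).
  apply: le_trans (pairing_le _ _) _; rewrite ler_wpM2l // ler_wpM2r //; exact: HBq.
(* In the dominating constant, L comes from the increment of F and d L from the Jacobian term, each
   multiplied by |y n - x| <= kap eps. *)
apply: (@prim_dct R _ _ (d%:R * (Bq * (L + d%:R * L)) * kap)).
- by move=> n; have [] := bmeasM (bmeas_cst (eps n)^-1) (brho n).
- move=> n s; rewrite normrM normfV (gtr0_norm (e0 n)) ler_pdivrMl //.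
  apply: le_trans (rho_le n s) _.
  have -> : eps n * (d%:R * (Bq * (L + d%:R * L)) * kap) =
    d%:R * (Bq * ((L + d%:R * L) * (kap * eps n))) by ring.
  rewrite ler_wpM2l // ler_wpM2l //; apply: le_trans (ler_normB _ _) _.
  rewrite mulrDl; apply: lerD.
    by apply: le_trans (F_lip (Uu n s) _ _) _; rewrite ler_wpM2l // ltW.
  apply: le_trans (@mulmx_norm_le _ _ _ _ _ L (ltW L_gt0) _) _.
    by move=> k l; exact: jac_along_le.
  by rewrite ler_wpM2l // mulr_ge0 // ltW.
(* At a fixed time [u n s] is eventually [v s], so plain differentiability of F(., v s) at x(s)
   gives the limit. *)
- move=> s _; apply/cvgrPdist_le => eta eta0.
  have c0 : 0 < d%:R * Bq * kap + 1 by rewrite ltr_wpDl // !mulr_ge0.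
  have [r r0 Hr] := differentiable_approx (F_diff (v s) (x s)) (divr_gt0 eta0 c0).
  have : (fun n => kap * eps n) @ \oo --> (0 : R).
    by rewrite -[X in _ --> X](mulr0 kap); apply: cvgM => //; exact: cvg_cst.
  move/cvgrPdist_lt => /(_ _ r0); apply: filterS2 (uv s) => n un.
  rewrite !sub0r !normrN ger0_norm ?mulr_ge0 // ?(ltW (e0 n)) // => small.
  rewrite normrM normfV (gtr0_norm (e0 n)) ler_pdivrMl //.
  apply: le_trans (rho_le n s) _; rewrite un.
  have := Hr (y n s - x s) (le_lt_trans (yx n s) small).
  rewrite diff_jacobian [x s + _]addrC subrK => H.
  apply: (@le_trans _ _ (d%:R * (Bq * (eta / (d%:R * Bq * kap + 1) * (kap * eps n))))).
    rewrite ler_wpM2l // ler_wpM2l //; apply: le_trans H _.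
    by rewrite ler_wpM2l // divr_ge0 ?ltW.
  have -> : d%:R * (Bq * (eta / (d%:R * Bq * kap + 1) * (kap * eps n))) =
    eps n * eta * ((d%:R * Bq * kap) / (d%:R * Bq * kap + 1)) by ring.
  rewrite ger_pMr ?mulr_gt0 // ler_pdivrMr // mul1r; lra.
- exact: measurable_cst.
Qed.

(** The terminal value of [q] turns q . (y - x) at T into - M^-1 times the first-order change of
    [g], whence the factor - M. The quotient is the Taylor remainder of [g] plus - M times the
    remainder of [duality_expansion] and the control increment. *)
Lemma cost_expansion (g : 'rV[R]_d -> R) x0 v x M q (u : nat -> R -> 'rV[R]_m)
    (y : nat -> R -> 'rV[R]_d) (eps : nat -> R) kap l :
  differentiable g (x T) -> 0 < M ->
  mvec v -> (forall s, U (v s)) ->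
  (forall n, mvec (u n)) -> (forall n s, U (u n s)) ->
  solves x0 v x -> adjoint_solves x v (- (M^-1 *: grad g (x T))) q ->
  (forall n, solves x0 (u n) (y n)) ->
  (forall n, 0 < eps n) -> eps @ \oo --> 0 -> 0 <= kap ->
  (forall n t, `|y n t - x t| <= kap * eps n) ->
  (forall s, \forall n \near \oo, u n s = v s) ->
  (fun n => prim (fun s => pairing (q s) (F (x s) (u n s) - F (x s) (v s))) T / eps n)
     @ \oo --> l ->
  (fun n => (g (y n T) - g (x T)) / eps n) @ \oo --> - (M * l).
Proof.
move=> dg M0 mv Uv mu_ Uu sx aq sy e0 ecvg kap0 yx uv Hl.
have Hd := duality_expansion mv Uv mu_ Uu sx aq sy e0 ecvg kap0 yx uv.
have Hg : (fun n => (g (y n T) - g (x T) - pairing (grad g (x T)) (y n T - x T)) / eps n)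
    @ \oo --> 0.
  apply/cvgrPdist_le => eta eta0; have k1 : 0 < kap + 1 by rewrite ltr_wpDl.
  have [r r0 Hr] := differentiable_approx dg (divr_gt0 eta0 k1).
  have : (fun n => kap * eps n) @ \oo --> (0 : R).
    by rewrite -[X in _ --> X](mulr0 kap); apply: cvgM => //; exact: cvg_cst.
  move/cvgrPdist_lt => /(_ _ r0); apply: filterS => n.
  rewrite !sub0r !normrN ger0_norm ?mulr_ge0 // ?(ltW (e0 n)) // => small.
  rewrite normrM normfV [`|eps n|]gtr0_norm // ler_pdivrMr //.
  have := Hr (y n T - x T) (le_lt_trans (yx n T) small).
  rewrite diff_grad // [x T + _]addrC subrK => /le_trans; apply.
  apply: (@le_trans _ _ (eta / (kap + 1) * (kap * eps n))).
    by rewrite ler_wpM2l // divr_ge0 ?ltW.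
  have -> : eta / (kap + 1) * (kap * eps n) = eta * eps n * (kap / (kap + 1)) by ring.
  rewrite ger_pMr ?mulr_gt0 // ler_pdivrMr // mul1r; lra.
have -> : (fun n => (g (y n T) - g (x T)) / eps n) = (fun n =>
  (g (y n T) - g (x T) - pairing (grad g (x T)) (y n T - x T)) / eps n +
  (- M) * ((pairing (- (M^-1 *: grad g (x T))) (y n T - x T) -
     prim (fun s => pairing (q s) (F (x s) (u n s) - F (x s) (v s))) T) / eps n +
   prim (fun s => pairing (q s) (F (x s) (u n s) - F (x s) (v s))) T / eps n)).
  apply/funext => n; rewrite -scaleNr pairingZl.
  field; rewrite !gt_eqF //.
have -> : - (M * l) = 0 + (- M) * (0 + l) by ring.
apply: cvgD => //; apply: cvgM; first exact: cvg_cst.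
exact: cvgD.
Qed.

End Expansion.

(** * Needle variations *)

Section Needles.
Context {R : realType} (m : nat).
Local Notation mu := (@lebesgue_measure R).

Section NeedleControl.
Variables (v : R -> 'rV[R]_m) (K : nat) (t c : 'I_K -> R) (w : 'I_K -> 'rV[R]_m).

(* The offsets make needles based at the same point t k adjacent rather than
   overlapping. *)
Definition offset (k : 'I_K) : R := \sum_(l < K | (l < k)%N) c l.

(** Half-open, so that adjacent needles are disjoint; open on the left, so that every time, [t k]
    included, is eventually outside the needles as eps tends to 0. *)
Definition needle_itv (eps : R) (k : 'I_K) : interval R :=
  `]t k + offset k * eps, t k + (offset k + c k) * eps].

Definition needle_rec eps (r : seq 'I_K) s : 'rV[R]_m :=
  foldr (fun k u => if s \in needle_itv eps k then w k else u) (v s) r.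

Definition needle eps s := needle_rec eps (enum 'I_K) s.

Lemma needle_mvec eps : mvec v -> mvec (needle eps).
Proof.
move=> mv; rewrite /needle; elim: (enum 'I_K) => [|k r IH] //= l.
have -> : (fun s => (if s \in needle_itv eps k then w k else needle_rec eps r s) ord0 l) =
  (fun s => if s \in needle_itv eps k then w k ord0 l else needle_rec eps r s ord0 l).
  by apply/funext => s; case: ifP.
apply: measurable_fun_ifT; [|exact: measurable_cst|exact: IH].
apply: (measurable_fun_bool true); rewrite setTI.
have -> : (fun s => s \in needle_itv eps k) @^-1` [set true] = [set` needle_itv eps k].
  by apply/seteqP; split.
exact: measurable_itv.
Qed.

Lemma needle_in (U : set 'rV[R]_m) eps s : U (v s) -> (forall k, U (w k)) -> U (needle eps s).
Proof.
by move=> Uv Uw; rewrite /needle; elim: (enum 'I_K) => [|k r IH] //=; case: ifP.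
Qed.

Lemma needle_bound eps s (phi : 'rV[R]_m -> R) B : 0 <= B ->
  (forall k, `|phi (w k) - phi (v s)| <= B) ->
  `|phi (needle eps s) - phi (v s)| <= \sum_k (s \in needle_itv eps k)%:R * B.
Proof.
move=> B0 HB; rewrite -big_enum /= /needle.
elim: (enum 'I_K) => [|k r IH] /=; first by rewrite big_nil subrr normr0.
rewrite big_cons; case: (s \in needle_itv eps k); last by rewrite mul0r add0r.
rewrite mul1r; apply: le_trans (HB k) _; rewrite lerDl.
by apply: sumr_ge0 => l _; rewrite mulr_ge0.
Qed.

Lemma needle_sum eps s (phi : 'rV[R]_m -> R) :
  (forall k l s, k != l -> s \in needle_itv eps k -> s \in needle_itv eps l -> False) ->
  phi (needle eps s) - phi (v s) =
    \sum_k (s \in needle_itv eps k)%:R * (phi (w k) - phi (v s)).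
Proof.
move=> disj; rewrite -big_enum /= /needle.
elim: (enum 'I_K) (enum_uniq 'I_K) => [|k r IH] /=; first by rewrite big_nil subrr.
move=> /andP[kr ur]; rewrite big_cons; case sk: (s \in needle_itv eps k); last first.
  by rewrite mul0r add0r; exact: IH.
rewrite mul1r big1_seq ?addr0 // => l /= lr; case sl: (s \in needle_itv eps l); last by rewrite mul0r.
have kl : k != l by apply: contraNneq kr => ->.
by have := disj _ _ _ kl sk sl.
Qed.

Hypothesis c_ge0 : forall k, 0 <= c k.

Lemma offset_ge0 k : 0 <= offset k.
Proof. exact: sumr_ge0. Qed.

Lemma offset_lt (k l : 'I_K) : (k < l)%N -> offset k + c k <= offset l.
Proof.
move=> kl; rewrite /offset [leRHS](bigD1 k) //= addrC lerD2r.
rewrite [leRHS](bigID (fun i : 'I_K => (i < k)%N)) /=.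
have -> : \sum_(i < K | (((i < l) && (i != k)) && (i < k))%N) c i = \sum_(i < K | (i < k)%N) c i.
  apply: eq_bigl => i; case: (ltnP i k) => ik; rewrite ?andbF //.
  by rewrite andbT (ltn_trans ik kl) neq_ltn ik.
by rewrite lerDl; exact: sumr_ge0.
Qed.

Lemma affine_lt_near (x y b : R) : x < y -> \forall e \near (0 : R)^'+, x + b * e < y.
Proof.
move=> xy; have b1 : 0 < `|b| + 1 by rewrite ltr_wpDl.
have d0 : 0 < (y - x) / (`|b| + 1) by rewrite divr_gt0 // subr_gt0.
near=> e; have e0 : 0 < e by near: e; exact: nbhs_right_gt.
have : e < (y - x) / (`|b| + 1) by near: e; exact: nbhs_right_lt.
rewrite ltr_pdivlMr // => H.
have : b * e <= `|b| * e by rewrite ler_pM2r // ler_norm.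
move: H e0; nra.
Unshelve. all: end_near. Qed.

(** Short needles at distinct base points are separated by finitely many strict inequalities, stable
    for small eps; at a common base point the offsets order them. *)
Lemma needle_good T : (forall k, 0 < t k < T) -> exists2 e0, 0 < e0 & forall eps, 0 < eps <= e0 ->
  (forall k, 0 <= t k + offset k * eps /\ t k + (offset k + c k) * eps <= T) /\
  (forall k l s, k != l -> s \in needle_itv eps k -> s \in needle_itv eps l -> False).
Proof.
move=> tT.
have HT : \forall e \near (0 : R)^'+, forall k, t k + (offset k + c k) * e < T.
  by apply: filter_forall => k; apply: affine_lt_near; have /andP[] := tT k.
have Ht : \forall e \near (0 : R)^'+, forall k l, t k < t l ->
    t k + (offset k + c k) * e < t l.
  apply: filter_forall => k; apply: filter_forall => l.
  have [kl|lk] := ltP (t k) (t l); last by apply: nearW.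
  apply: filterS (affine_lt_near (offset k + c k) kl) => e h _; exact: h.
have H : \forall e \near (0 : R)^'+, (forall k, t k + (offset k + c k) * e < T) /\
    (forall k l, t k < t l -> t k + (offset k + c k) * e < t l).
  by apply: filterS2 HT Ht.
move: H => /nbhs_ballP[r /= r0 Hr]; exists (r / 2); first exact: divr_gt0.
move=> eps /andP[e0 er].
have [H1 H2] : (forall k, t k + (offset k + c k) * eps < T) /\
    (forall k l, t k < t l -> t k + (offset k + c k) * eps < t l).
  by apply: Hr => //; rewrite /ball /= sub0r normrN gtr0_norm //; lra.
split=> [k|].
  split; last exact/ltW.
  by rewrite addr_ge0 ?mulr_ge0 ?offset_ge0 ?ltW //; case/andP: (tT k).
have main k l s : t k < t l -> s \in needle_itv eps k -> s \in needle_itv eps l -> False.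
  move=> kl; rewrite !in_itv /= => /andP[_ h1] /andP[h2 _].
  have h3 := H2 k l kl; have h4 := mulr_ge0 (offset_ge0 l) (ltW e0); lra.
have same (k l : 'I_K) s : t k = t l -> (k < l)%N -> s \in needle_itv eps k ->
    s \in needle_itv eps l -> False.
  move=> tkl kl; rewrite !in_itv /= => /andP[_ h1] /andP[h2 _].
  have := ler_wpM2r (ltW e0) (offset_lt kl); lra.
move=> k l s kl sk sl; case: (ltgtP (t k) (t l)) => h.
- exact: main h sk sl.
- exact: main h sl sk.
- by have /orP[h'|h'] : ((k < l) || (l < k))%N; [rewrite -neq_ltn | exact: same h h' sk sl
    | exact: same (esym h) h' sl sk].
Qed.

(** The threshold depends on [s]; such pointwise convergence is the form that dominated convergence
    takes. *)
Lemma needle_eventually (eps : nat -> R) s : (forall n, 0 < eps n) -> eps @ \oo --> 0 ->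
  \forall n \near \oo, needle (eps n) s = v s.
Proof.
move=> e0 ecvg.
have H : \forall n \near \oo, forall k, s \notin needle_itv (eps n) k.
  apply: filter_forall => k; have [st|ts] := leP s (t k).
    apply: nearW => n; rewrite in_itv /= negb_and -leNgt.
    by apply/orP; left; apply: (le_trans st); rewrite lerDl mulr_ge0 ?offset_ge0 // ltW.
  have b0 : 0 <= offset k + c k by rewrite addr_ge0 ?offset_ge0.
  have b1 : 0 < offset k + c k + 1 by rewrite ltr_wpDl.
  have d0 : 0 < (s - t k) / (offset k + c k + 1) by rewrite divr_gt0 ?subr_gt0.
  have /cvgrPdist_lt /(_ _ d0) := ecvg; apply: filterS => n.
  rewrite sub0r normrN gtr0_norm // ltr_pdivlMr // => h.
  rewrite in_itv /= negb_and -!ltNge; apply/orP; right.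
  have := e0 n; lra.
apply: filterS H => n H; rewrite /needle; elim: (enum 'I_K) => [|k r IH] //=.
by rewrite (negbTE (H k)).
Qed.

End NeedleControl.

Lemma prim_indic (h : R -> R) a b T : bmeas h -> 0 <= a -> a <= b -> b <= T ->
  prim (fun s => (s \in `]a, b])%:R * h s) T = prim h b - prim h a.
Proof.
move=> bh a0 ab bT; rewrite prim_itvB //.
have -> : `]a, b]%classic = `]a, b]%classic `&` `[0, T]%classic.
  apply/seteqP; split => s /=; last by case.
  rewrite !in_itv /= => /andP[as_ sb]; split; first by rewrite as_.
  by rewrite (le_trans a0 (ltW as_)) (le_trans sb).
rewrite Rintegral_mkcondl /prim; apply: eq_Rintegral => s _.
by rewrite patchE mem_setE; case: ifP => _; rewrite ?mul1r ?mul0r.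
Qed.

Lemma bmeas_indic (a b : R) : bmeas (fun s : R => (s \in `]a, b])%:R).
Proof.
split; last by exists 1 => s; case: (s \in _); rewrite ?normr1 ?normr0.
have -> : (fun s : R => (s \in `]a, b])%:R) = (fun s : R => if s \in `]a, b] then 1 else 0 : R).
  by apply/funext => s; case: ifP.
apply: measurable_fun_ifT; try exact: measurable_cst.
apply: (measurable_fun_bool true); rewrite setTI.
have -> : (fun s => s \in `]a, b]) @^-1` [set true] = [set` `]a, b]].
  by apply/seteqP; split.
exact: measurable_itv.
Qed.

Lemma derive_quotient_cvg (P : R -> R) x l b (eps : nat -> R) : is_derive x (1 : R) P l ->
  (forall n, 0 < eps n) -> eps @ \oo --> 0 ->
  (fun n => (P (x + b * eps n) - P x) / eps n) @ \oo --> b * l.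
Proof.
move=> [dP <-] e0 ecvg; have dfP : differentiable P x by exact/derivable1_diffP.
apply/cvgrPdist_le => eta eta0; have b1 : 0 < `|b| + 1 by rewrite ltr_wpDl.
have [r r0 Hr] := differentiable_approx dfP (divr_gt0 eta0 b1).
have : (fun n => b * eps n) @ \oo --> (0 : R).
  by rewrite -[X in _ --> X](mulr0 b); apply: cvgM => //; exact: cvg_cst.
move/cvgrPdist_lt => /(_ _ r0); apply: filterS => n.
rewrite sub0r normrN => small; have := Hr _ small.
have -> : 'd P x (b * eps n) = b * eps n * 'D_1 P x.
  rewrite deriveE // -[RHS]/((b * eps n) *: 'd P x 1) -linearZ /=.
  by congr ('d P x _); rewrite /GRing.scale /= mulr1.
move=> H.
have -> : b * 'D_1 P x - (P (x + b * eps n) - P x) / eps n =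
  - (P (x + b * eps n) - P x - b * eps n * 'D_1 P x) / eps n.
  by field; rewrite gt_eqF.
rewrite normrM normrN normfV [`|eps n|]gtr0_norm // ler_pdivrMr //.
apply: le_trans H _; rewrite normrM [`|eps n|]gtr0_norm //.
have -> : eta / (`|b| + 1) * (`|b| * eps n) = eta * eps n * (`|b| / (`|b| + 1)) by ring.
by rewrite ger_pMr ?mulr_gt0 // ler_pdivrMr // mul1r lerDl.
Qed.

(** A needle contributes the difference of two increments of a primitive, both taken from [t k];
    divided by eps they tend to (offset + c) h and offset h, so the offsets cancel. *)
Lemma needle_limit (v : R -> 'rV[R]_m) K (t c : 'I_K -> R) (w : 'I_K -> 'rV[R]_m)
    (phi : R -> 'rV[R]_m -> R) (h : 'I_K -> R) (eps : nat -> R) T :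
  (forall k, 0 <= c k) ->
  (forall s, phi s (v s) = 0) -> (forall k, bmeas (fun s => phi s (w k))) ->
  (forall k, is_derive (t k) (1 : R) (prim (fun s => phi s (w k))) (h k)) ->
  (forall n, 0 < eps n) -> eps @ \oo --> 0 ->
  (forall n k, 0 <= t k + offset c k * eps n /\ t k + (offset c k + c k) * eps n <= T) ->
  (forall n k l s, k != l -> s \in needle_itv t c (eps n) k ->
     s \in needle_itv t c (eps n) l -> False) ->
  (fun n => prim (fun s => phi s (needle v t c w (eps n) s)) T / eps n) @ \oo -->
    \sum_k c k * h k.
Proof.
move=> c0 phi0 bphi dphi e0 ecvg inT disj.
have -> : (fun n => prim (fun s => phi s (needle v t c w (eps n) s)) T / eps n) =
  (fun n => \sum_k
     ((prim (fun s => phi s (w k)) (t k + (offset c k + c k) * eps n) -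
       prim (fun s => phi s (w k)) (t k)) / eps n -
      (prim (fun s => phi s (w k)) (t k + offset c k * eps n) -
       prim (fun s => phi s (w k)) (t k)) / eps n)).
  apply/funext => n.
  have -> : prim (fun s => phi s (needle v t c w (eps n) s)) T =
     prim (fun s => \sum_k (s \in needle_itv t c (eps n) k)%:R * phi s (w k)) T.
    apply: eq_prim => s _; have := needle_sum v w s (phi s) (disj n).
    rewrite phi0 subr0 => ->.
    by apply: eq_bigr => k _; rewrite subr0.
  rewrite prim_sum; last by move=> k; apply: bmeasM => //; exact: bmeas_indic.
  rewrite mulr_suml; apply: eq_bigr => k _; have [h1 h2] := inT n k.
  rewrite prim_indic //; first by ring.
  by rewrite lerD2l ler_pM2r // lerDl.
apply: (@cvg_big _ _ _ _ _ _ _ \oo); first exact: add_continuous.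
move=> k _.
have -> : c k * h k = (offset c k + c k) * h k - offset c k * h k by ring.
by apply: cvgB; exact: derive_quotient_cvg.
Qed.

End Needles.

(** * The common multiplier *)

Section MultiplierSet.
Context {R : realType} (M N : nat).
Implicit Types (A : 'I_M -> 'I_N -> Prop) (x : 'rV[R]_(M * N)).

(** A product of simplices, one for each i, restricted to the indices allowed by [A]; flattened so
    that [multiplier_exists] applies. *)
Definition multipliers A : set 'rV[R]_(M * N) := [set x |
  [/\ forall i j, 0 <= (vec_mx x) i j, forall i j, ~ A i j -> (vec_mx x) i j = 0 &
      forall i, \sum_j (vec_mx x) i j = 1]].

Lemma pairing_mxvec (a : 'M[R]_(M, N)) x :
  pairing (mxvec a) x = \sum_i \sum_j a i j * (vec_mx x) i j.
Proof.
rewrite /pairing (reindex _ (curry_mxvec_bij M N)) /= pair_bigA /=.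
by apply: eq_bigr => -[i j] _ /=; rewrite mxvecE mxE.
Qed.

Lemma continuous_vec_mx i j : continuous (fun x : 'rV[R]_(M * N) => (vec_mx x) i j).
Proof. under eq_fun do rewrite mxE; exact: coord_continuous. Qed.

Lemma multipliers_compact A : compact (multipliers A).
Proof.
apply: bounded_closed_compact.
  exists 1; split=> [|c c1 x [x0 _ x1]]; first exact: num_real.
  apply: norm_le_coord => [|k]; first exact: le_trans (ltW c1).
  case/mxvec_indexP: k => i j.
  have -> : x ord0 (mxvec_index i j) = (vec_mx x) i j by rewrite mxE.
  rewrite ger0_norm //; apply: le_trans (ltW c1); rewrite -(x1 i) (bigD1 j) //= lerDl.
  exact: sumr_ge0.
have -> : multipliers A = (\bigcap_(i in setT) \bigcap_(j in setT) [set x | 0 <= (vec_mx x) i j])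
   `&` (\bigcap_(i in setT) \bigcap_(j in [set j | ~ A i j]) [set x | (vec_mx x) i j = 0])
   `&` (\bigcap_(i in setT) [set x | \sum_j (vec_mx x) i j = 1]).
  apply/seteqP; split => x /=.
    move=> [h1 h2 h3]; split; first split.
    - by move=> i _ j _; exact: h1.
    - by move=> i _ j; exact: h2.
    - by move=> i _; exact: h3.
  move=> [[h1 h2] h3]; split.
  - by move=> i j; exact: h1.
  - by move=> i j; exact: h2.
  - by move=> i; exact: h3.
apply: closedI; first apply: closedI.
- apply: closed_bigI => i _; apply: closed_bigI => j _.
  apply: (@closed_comp _ _ (fun x => (vec_mx x) i j) [set z | 0 <= z]); last exact: closed_ge.
  by move=> x _; exact: continuous_vec_mx.
- apply: closed_bigI => i _; apply: closed_bigI => j _.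
  apply: (@closed_comp _ _ (fun x => (vec_mx x) i j) [set z | z = 0]); last exact: closed_eq.
  by move=> x _; exact: continuous_vec_mx.
- apply: closed_bigI => i _.
  apply: (@closed_comp _ _ (fun x => \sum_j (vec_mx x) i j) [set z | z = 1]); last exact: closed_eq.
  move=> x _; apply: continuous_big; first exact: add_continuous.
  by move=> j _; exact: continuous_vec_mx.
Qed.

Lemma multipliers_convex A : convex_set (multipliers A).
Proof.
move=> x y t [x0 xA x1] [y0 yA y1] /andP[t0 t1].
have E i j : (vec_mx (x + t *: (y - x))) i j =
    (1 - t) * (vec_mx x) i j + t * (vec_mx y) i j by rewrite !mxE; ring.
split.
- by move=> i j; rewrite E addr_ge0 // mulr_ge0 // subr_ge0.
- by move=> i j nA; rewrite E xA // yA // !mulr0 addr0.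
- move=> i; under eq_bigr do rewrite E.
  by rewrite big_split /= -!mulr_sumr x1 y1 !mulr1 subrK.
Qed.

(** A lower bound valid on all multipliers can be tested at the vertex that puts full weight on
    [sigma]. *)
Lemma multipliers_vertex A (sigma : 'I_M -> 'I_N) (a : 'M[R]_(M, N)) :
  (forall i, A i (sigma i)) ->
  exists2 x, multipliers A x & pairing (mxvec a) x = \sum_i a i (sigma i).
Proof.
move=> As; pose e := \matrix_(i, j) (j == sigma i)%:R : 'M[R]_(M, N).
have Ee i (f : 'I_N -> R) : \sum_j f j * e i j = f (sigma i).
  rewrite (bigD1 (sigma i)) //= mxE eqxx mulr1 big1 ?addr0 // => j /negbTE js.
  by rewrite mxE js mulr0.
exists (mxvec e); last first.
  by rewrite pairing_mxvec mxvecK; apply: eq_bigr => i _; exact: Ee.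
split; rewrite mxvecK.
- by move=> i j; rewrite mxE.
- by move=> i j nA; rewrite mxE; case: eqP => // js; case: nA; rewrite js; exact: As.
- by move=> i; rewrite -[RHS](Ee i (fun=> 1)); apply: eq_bigr => j _; rewrite mul1r.
Qed.

End MultiplierSet.

(** * Needle variations of a minimizer *)

Section NeedleVariation.
Context {R : realType} (d m M N : nat).
Variables (F : 'rV[R]_d -> 'rV[R]_m -> 'rV[R]_d) (U : set 'rV[R]_m) (L T r : R).
Hypothesis U_compact : compact U.
Hypothesis F_continuous : continuous (fun z : 'rV[R]_d * 'rV[R]_m => F z.1 z.2).
Hypothesis L_gt0 : 0 < L.
Hypothesis F_lip : forall w, U w -> forall x y, `|F x w - F y w| <= L * `|x - y|.
Hypothesis F_diff : forall w x, differentiable (fun y => F y w) x.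
Hypothesis T_gt0 : 0 < T.
Hypothesis r_gt0 : 0 < r.
Variables (g : 'I_M -> 'rV[R]_d -> R) (x0 : 'I_M -> 'I_N.+1 -> 'rV[R]_d).
Variables (v : R -> 'rV[R]_m) (x q : 'I_M -> 'I_N.+1 -> R -> 'rV[R]_d).
Hypothesis mv : mvec v.
Hypothesis Uv : forall s, U (v s).
Hypothesis sx : forall i j, solves F T (x0 i j) v (x i j).
Hypothesis xc : forall i j t, x i j (clamp T t) = x i j t.
Hypothesis g_diff : forall i j, differentiable (g i) (x i j T).
Hypothesis aq : forall i j,
  adjoint_solves F T (x i j) v (- (r^-1 *: grad (g i) (x i j T))) (q i j).
Hypothesis minimal : exists2 e, 0 < e & forall u y, mvec u -> (forall s, U (u s)) ->
  (forall i j, solves F T (x0 i j) u (y i j)) ->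
  (forall i j t, `|y i j t - x i j t| <= e) ->
  \sum_i ord_max_val (fun j => g i (x i j T)) <= \sum_i ord_max_val (fun j => g i (y i j T)).

(** The integrand is at most 2 sup |F| and vanishes off needles of total length (\sum_k c_k) eps.
    [B] is fixed before the needles, so the bound is linear in eps. *)
Lemma needle_defect i j : exists2 B, 0 <= B & forall K (t c : 'I_K -> R)
    (w : 'I_K -> 'rV[R]_m) eps,
  (forall k, 0 <= c k) -> (forall k, U (w k)) -> 0 <= eps ->
  (forall k, 0 <= t k + offset c k * eps /\ t k + (offset c k + c k) * eps <= T) ->
  forall s l, 0 <= s <= T ->
    prim (fun s => `|F (x i j s) (needle v t c w eps s) ord0 l - F (x i j s) (v s) ord0 l|) s
      <= B * (\sum_k c k) * eps.
Proof.
have [bx _] := sx i j; have [B0 HB0] := bvec_bounded bx.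
have [B HB] := F_bounded U_compact F_continuous L_gt0 F_lip B0.
have HBx s w : U w -> `|F (x i j s) w| <= B by move=> Uw; exact: HB.
have B_ge0 : 0 <= B by exact: le_trans (HBx 0 (v 0) (Uv 0)).
exists (2 * B); first exact: mulr_ge0.
move=> K t c w eps c0 Uw e0 inT s l /andP[s0 sT].
have bF := bvec_F U_compact F_continuous L_gt0 F_lip bx.
have mn := needle_mvec t c w eps mv.
have Un s' : U (needle v t c w eps s') by apply: (@needle_in R m v K t c w U).
have bk k : bmeas (fun s' => (s' \in needle_itv t c eps k)%:R * (2 * B)).
  by apply: bmeasM; [exact: bmeas_indic | exact: bmeas_cst].
apply: (@le_trans _ _ (prim (fun s' => \sum_k (s' \in needle_itv t c eps k)%:R * (2 * B)) s)).
  apply: prim_le.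
  - exact: bmeas_abs (bmeasB (bF _ mn Un l) (bF _ mv Uv l)).
  - exact: bmeas_sum.
  - move=> s' _; apply: (@needle_bound R m v K t c w eps s' (fun w' => F (x i j s') w' ord0 l)).
      exact: mulr_ge0.
    move=> k; apply: le_trans (ler_normB _ _) _.
    have -> : 2 * B = B + B by ring.
    by apply: lerD; apply: le_trans (coord_le_norm _ _) _; exact: HBx.
rewrite prim_sum // mulr_sumr mulr_suml; apply: ler_sum => k _; have [h1 h2] := inT k.
apply: (@le_trans _ _ (prim (fun s' => (s' \in needle_itv t c eps k)%:R * (2 * B)) T)).
  (* The primitive of a nonnegative function increases, by comparison with the zero function. *)
  rewrite -subr_ge0; apply: le_trans (prim_incr_le (bmeas_cst 0) (bk k) s0 sT _); first exact: normr_ge0.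
  by move=> s'; rewrite normr0 !mulr_ge0.
rewrite (@prim_indic _ (fun=> 2 * B)) //; first last.
- by rewrite lerD2l ler_wpM2r // lerDl.
- exact: bmeas_cst.
rewrite !prim_cst //; last first.
  by apply: le_trans h1 _; rewrite lerD2l ler_wpM2r // lerDl.
by rewrite le_eqVlt; apply/orP; left; apply/eqP; ring.
Qed.

(** Needles of vanishing length produce competitors that enter the minimality radius; their
    expansions feed [active_selection]. *)
Lemma needle_inequality K (t c : 'I_K -> R) (w : 'I_K -> 'rV[R]_m)
    (h : 'I_M -> 'I_N.+1 -> 'I_K -> R) :
  (forall k, 0 < t k < T) -> (forall k, 0 <= c k) -> (forall k, U (w k)) ->
  (forall i j k, is_derive (t k) (1 : R)
     (prim (fun s => pairing (q i j s) (F (x i j s) (w k) - F (x i j s) (v s)))) (h i j k)) ->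
  exists sigma : 'I_M -> 'I_N.+1,
    (forall i, argmax (fun j => g i (x i j T)) (sigma i)) /\
    \sum_i \sum_k c k * h i (sigma i) k <= 0.
Proof.
move=> tT c0 Uw dh.
have [e0 e00 He0] := needle_good c0 tT.
pose eps n : R := e0 * n.+1%:R^-1.
have eps0 n : 0 < eps n by rewrite mulr_gt0 // invr_gt0.
have epscvg : eps @ \oo --> 0.
  rewrite -[X in _ --> X](mulr0 e0); apply: cvgM; first exact: cvg_cst.
  exact: (@cvg_harmonic R).
have epsle n : 0 < eps n <= e0.
  by rewrite eps0 /= ger_pMr // invf_le1 // ler1n.
pose u n := needle v t c w (eps n).
have mu_ n : mvec (u n) by apply: needle_mvec.
have Uu n s : U (u n s) by apply: (@needle_in R m v K t c w U).
have uv s : \forall n \near \oo, u n s = v s by apply: needle_eventually.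
have inT n := (He0 _ (epsle n)).1; have disj n := (He0 _ (epsle n)).2.
have c_ge0 : 0 <= \sum_k c k by exact: sumr_ge0.
(* [kap] is chosen before [n], so one constant bounds the distance for the whole sequence. *)
have /choice[kap Hkap] : forall p : 'I_M * 'I_N.+1, exists kap, 0 <= kap /\ forall n, exists y,
    solves F T (x0 p.1 p.2) (u n) y /\ forall s, `|y s - x p.1 p.2 s| <= kap * eps n.
  move=> [i j] /=; have [B B0 HB] := needle_defect i j.
  exists (2 * (B * (\sum_k c k)) * expR (2 * L * T)); split.
    by rewrite !mulr_ge0 // expR_ge0.
  move=> n.
  have [||y sy Hy] := @perturbation_exists R d m F U L T U_compact F_continuous L_gt0 F_lip
    T_gt0 (x0 i j) v (x i j) (u n) (B * (\sum_k c k) * eps n) mv Uv (mu_ n) (Uu n) (sx i j) (xc i j).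
  - by rewrite mulr_ge0 ?mulr_ge0 // ltW.
  - by move=> s l sT; apply: HB => //; exact: ltW.
  exists y; split => // s; apply: le_trans (Hy s) _.
  by rewrite le_eqVlt; apply/orP; left; apply/eqP; ring.
have kap0 i j : 0 <= kap (i, j) by have [] := Hkap (i, j).
have /choice[y Hy] : forall p : nat * ('I_M * 'I_N.+1), exists y,
    solves F T (x0 p.2.1 p.2.2) (u p.1) y /\
    forall s, `|y s - x p.2.1 p.2.2 s| <= kap p.2 * eps p.1.
  by move=> [n p] /=; have [_] := Hkap p; apply.
have sy i j n : solves F T (x0 i j) (u n) (y (n, (i, j))) by have [] := Hy (n, (i, j)).
have yx i j n s : `|y (n, (i, j)) s - x i j s| <= kap (i, j) * eps n.
  by have [_] := Hy (n, (i, j)); apply.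
have gcvg i j : (fun n => (g i (y (n, (i, j)) T) - g i (x i j T)) / eps n) @ \oo -->
    - (r * \sum_k c k * h i j k).
  have [bq _] := aq i j; have [bx _] := sx i j.
  have bF := bvec_F U_compact F_continuous L_gt0 F_lip bx.
  apply: (@cost_expansion R d m F U L T U_compact F_continuous L_gt0 F_lip F_diff T_gt0
    (g i) (x0 i j) v (x i j) r (q i j) u (fun n => y (n, (i, j))) eps (kap (i, j))) => //.
  apply: (@needle_limit R m v K t c w
    (fun s w' => pairing (q i j s) (F (x i j s) w' - F (x i j s) (v s)))) => //.
  - by move=> s; rewrite subrr /pairing big1 // => k _; rewrite mxE mulr0.
  - move=> k; apply: bmeas_pairing => //; apply: bvecB; last exact: bF.
    by apply: (bF (fun=> w k)) => // l; exact: measurable_cst.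
have cost : \forall n \near \oo, \sum_i ord_max_val (fun j => g i (x i j T)) <=
    \sum_i ord_max_val (fun j => g i (y (n, (i, j)) T)).
  have [e e_gt0 He] := minimal.
  have small : \forall n \near \oo, forall p, kap p * eps n <= e.
    apply: filter_forall => p.
    have : (fun n => kap p * eps n) @ \oo --> (0 : R).
      by rewrite -[X in _ --> X](mulr0 (kap p)); apply: cvgM => //; exact: cvg_cst.
    move/cvgrPdist_le => /(_ _ e_gt0); apply: filterS => n.
    by rewrite sub0r normrN; apply: le_trans; exact: ler_norm.
  apply: filterS small => n small; apply: (He (u n) (fun i j => y (n, (i, j)))) => //.
  by move=> i j s; apply: le_trans (yx i j n s) _; exact: small.
have [sigma [H1 H2]] := @active_selection R M N (fun i j => g i (x i j T))
  (fun i j => \sum_k c k * h i j k) (fun i j n => g i (y (n, (i, j)) T)) eps r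
  eps0 epscvg r_gt0 gcvg cost.
by exists sigma.
Qed.

Lemma common_multiplier :
  exists2 gamma : 'I_M -> 'I_N.+1 -> R,
    [/\ forall i j, 0 <= gamma i j, forall i, \sum_j gamma i j = 1 &
        forall i j, 0 < gamma i j -> argmax (fun k => g i (x i k T)) j] &
    forall t w (h : 'I_M -> 'I_N.+1 -> R), 0 < t < T -> U w ->
      (forall i j, is_derive t (1 : R)
        (prim (fun s => pairing (q i j s) (F (x i j s) w - F (x i j s) (v s)))) (h i j)) ->
      \sum_i \sum_j gamma i j * h i j <= 0.
Proof.
pose A i j := argmax (fun k => g i (x i k T)) j.
(* The increment matrices of all admissible pairs (t, w) at once, so that the multiplier is found
   before t and w are given. *)
pose D := [set a : 'rV[R]_(M * N.+1) | exists t w (h : 'I_M -> 'I_N.+1 -> R),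
  [/\ 0 < t < T, U w, a = mxvec (\matrix_(i, j) h i j) &
   forall i j, is_derive t (1 : R)
     (prim (fun s => pairing (q i j s) (F (x i j s) w - F (x i j s) (v s)))) (h i j)]].
have [||||gamma [g0 gA g1] Hg] := @multiplier_exists R (M * N.+1) (multipliers A) D.
- exact: multipliers_compact.
- have /choice[sigma Hs] : forall i, exists j, A i j.
    move=> i; have [|j _ Hj] := @argmax_exists R _ (fun j => g i (x i j T)) (fun=> True).
      by exists ord0.
    by exists j => k; exact: Hj.
  by have [z Gz _] := multipliers_vertex (0 : 'M[R]_(M, N.+1)) Hs; exists z.
- exact: multipliers_convex.
- move=> K a c del /choice[t] /choice[w] /choice[h Hh] c0 del0 H.
  have [||||sigma [As Hsigma]] := @needle_inequality K t c w (fun i j k => h k i j).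
  - by move=> k; have [] := Hh k.
  - exact: c0.
  - by move=> k; have [] := Hh k.
  - by move=> i j k; have [_ _ _] := Hh k; apply.
  have [z Gz Ez] := @multipliers_vertex R M N.+1 A sigma (\sum_k c k *: \matrix_(i, j) h k i j) As.
  (* At the vertex [z] the combination is at least [del] by assumption and at most 0 by
     [needle_inequality]. *)
  suff : 0 < 0 :> R by rewrite ltxx.
  apply: lt_le_trans del0 _; apply: le_trans (H z Gz) _; apply: le_trans Hsigma.
  have -> : \sum_k c k * pairing (a k) z = pairing (mxvec (\sum_k c k *: \matrix_(i, j) h k i j)) z.
    rewrite linear_sum /= /pairing; under eq_bigr do rewrite mulr_sumr.
    rewrite exchange_big /=; apply: eq_bigr => l _; rewrite summxE mulr_suml.
    by apply: eq_bigr => k _; have [_ _ -> _] := Hh k; rewrite linearZ mxE /= mulrA.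
  rewrite Ez le_eqVlt; apply/orP; left; apply/eqP; apply: eq_bigr => i _.
  by rewrite summxE; apply: eq_bigr => k _; rewrite !mxE.
exists (fun i j => (vec_mx gamma) i j).
  split => // i j gij; apply: contrapT => nA; have := gA i j nA => E.
  by rewrite E ltxx in gij.
move=> t w h tT Uw dh.
have := Hg (mxvec (\matrix_(i, j) h i j)).
have Da : D (mxvec (\matrix_(i, j) h i j)) by exists t, w, h.
move=> /(_ Da); rewrite pairing_mxvec; apply: le_trans.
rewrite le_eqVlt; apply/orP; left; apply/eqP; apply: eq_bigr => i _.
by apply: eq_bigr => j _; rewrite mxE mulrC.
Qed.

End NeedleVariation.

(** * From integral equations back to trajectories *)

Section PointwiseDerivative.
Context {R : realType}.
Local Notation mu := (@lebesgue_measure R).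

Lemma prim_continuous (x h : R -> R) c T t : bmeas h ->
  (forall s, 0 <= s <= T -> x s = c + prim h s) -> 0 < t < T -> {for t, continuous x}.
Proof.
move=> bh xh /andP[t0 tT]; have [_ [K HK]] := bh.
have K0 : 0 <= K by exact: le_trans (HK 0).
apply/cvgrPdist_le => e e0.
have K1 : 0 < K + 1 by rewrite ltr_wpDl.
have d0 : 0 < e / (K + 1) by rewrite divr_gt0.
near=> s.
have /andP[s0 sT] : 0 < s < T.
  suff : s \in `]0, T[ by rewrite in_itv.
  by near: s; apply: near_in_itvoo; rewrite in_itv /= t0.
rewrite !xh ?(ltW s0) ?(ltW sT) ?(ltW t0) ?(ltW tT) // opprD addrACA subrr add0r.
apply: le_trans (prim_lip bh HK (ltW s0) (ltW t0)) _.
have : `|t - s| <= e / (K + 1) by near: s; exact: (@cvgr_dist_le _ _ _ (nbhs t) _ id).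
rewrite ler_pdivlMr // => H; apply: le_trans H.
by rewrite mulrC ler_wpM2l // lerDl.
Unshelve. all: end_near. Qed.

Lemma continuous_prim_derive (f : R -> R) t : bmeas f -> 0 < t -> {for t, continuous f} ->
  is_derive t (1 : R) (prim f) (f t).
Proof.
move=> bf t0 cf.
have [] := @continuous_FTC1 R f (BLeft 0) t (t + 1) _ (bmeas_integrable 0 (t + 1) bf) _ cf.
- by rewrite ltrDl.
- exact: t0.
by move=> dt e; apply: DeriveDef => //; rewrite -derive1E.
Qed.

End PointwiseDerivative.

Section Admissibility.
Context {R : realType} (d m : nat).
Local Notation mu := (@lebesgue_measure R).
Variables (F : 'rV[R]_d -> 'rV[R]_m -> 'rV[R]_d) (U : set 'rV[R]_m) (L T : R).
Hypothesis U_compact : compact U.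
Hypothesis F_continuous : continuous (fun z : 'rV[R]_d * 'rV[R]_m => F z.1 z.2).
Hypothesis L_gt0 : 0 < L.
Hypothesis F_lip : forall w, U w -> forall x y, `|F x w - F y w| <= L * `|x - y|.
Hypothesis T_gt0 : 0 < T.

Lemma mvec_control u : mvec u -> (forall s, U (u s)) -> control T U u.
Proof.
move=> mu_ Uu; split.
- by move=> k; apply: measurable_funTS; exact: mu_.
- have [B [_ HB]] := compact_bounded U_compact.
  have bu : bvec u.
    apply: (@mvec_bvec _ _ _ (`|B| + 1)) => // s; apply: HB; last exact: Uu.
    by rewrite (le_lt_trans (ler_norm B)) // ltrDl.
  apply: (bmeas_integrable (h := fun s => enorm (u s) ^+ 2)).
  have -> : (fun s => enorm (u s) ^+ 2) = (fun s => \sum_k u s ord0 k * u s ord0 k).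
    apply/funext => s; rewrite sqr_sqrtr; last by apply: sumr_ge0 => k _; exact: sqr_ge0.
    by apply: eq_bigr => k _; rewrite expr2.
  by apply: bmeas_sum => k; exact: bmeasM.
- by apply: aeW => t _; exact: Uu.
Qed.

Lemma solves_trajectory u x0 x : mvec u -> (forall s, U (u s)) -> solves F T x0 u x ->
  trajectory T F u x0 x.
Proof.
move=> mu_ Uu [bx Hx].
have bF := bvec_F U_compact F_continuous L_gt0 F_lip bx mu_ Uu.
have [acx dx] := prim_trajectory bF Hx; split => //.
by apply/rowP => k; rewrite Hx ?lexx ?ltW // prim0 addr0.
Qed.

Lemma trajectory_solves u v x0 x : mvec v -> (forall s, U (v s)) ->
  {ae mu, forall t, t \in `[0, T] -> u t = v t} -> trajectory T F u x0 x ->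
  solves F T x0 v (fun t => x (clamp T t)).
Proof.
move=> mv Uv uv [acx dx x_0]; have T0 := ltW T_gt0.
have bx := ac_bvec T0 acx; split => // t k tT.
have bF := bvec_F U_compact F_continuous L_gt0 F_lip bx mv Uv.
rewrite clamp_id // -x_0; apply: (trajectory_prim T0 acx bF) => //.
have aeF := ae_filter_ringOfSetsType mu.
apply: filterS2 uv dx => s us ds sT; rewrite -(us sT).
have -> : clamp T s = s by apply: clamp_id; move: sT; rewrite in_itv.
exact: ds.
Qed.

Lemma adjoint_solves_curve u v x qT q gam :
  (forall w y, differentiable (fun z => F z w) y) ->
  mvec v -> (forall s, U (v s)) ->
  {ae mu, forall t, t \in `[0, T] -> u t = v t} -> bvec (fun t => x (clamp T t)) ->
  adjoint_solves F T (fun t => x (clamp T t)) v qT q ->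
  adjoint_curve T F u x (gam *: qT) (fun t => gam *: q t).
Proof.
move=> F_diff mv Uv uv bx [bq Hq]; have T0 := ltW T_gt0.
pose A := jac_along F (fun t => x (clamp T t)) v.
have bqA : bvec (fun s => q s *m (A s)^T).
  apply: bvec_mulmx => // k l.
  exact: (bmeas_jac_alongT U_compact F_continuous L_gt0 F_lip F_diff).
have bh : bvec (fun s => - gam *: (q s *m (A s)^T)).
  by move=> k; under eq_fun do rewrite mxE; apply: bmeasM => //; exact: bmeas_cst.
(* Value of gam q at time 0, which rewrites the backward equation as a forward primitive. *)
pose c := gam *: (qT + \row_k prim (fun s => (q s *m (A s)^T) ord0 k) T).
have [|ac_p dp] := @prim_trajectory R d T (fun t => gam *: q t)
  (fun s => - gam *: (q s *m (A s)^T)) c bh.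
  move=> t k tT; rewrite /c !mxE Hq //.
  have -> : prim (fun s => (- gam *: (q s *m (A s)^T)) ord0 k) t =
      - gam * prim (fun s => (q s *m (A s)^T) ord0 k) t.
    by rewrite -(primZ _ _ (bqA k)); apply: eq_prim => s _; rewrite [in LHS]mxE.
  rewrite /A; ring.
split => //; last by congr (_ *: _); apply/rowP => k; rewrite Hq ?lexx ?T0 // subrr addr0.
have aeF := ae_filter_ringOfSetsType mu.
apply: filterS2 uv dp => t ut dt tT.
have -> : - (gam *: q t *m Jac (F^~ (u t)) (x t)) = - gam *: (q t *m (A t)^T).
  rewrite -scalemxAl scaleNr /A /jac_along /Jac (ut tT) clamp_id //.
exact: dt.
Qed.

(** With [w] frozen the integrand is continuous at every interior time, so differentiability is
    assumed only for the term with [v], which is independent of [w]. *)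
Lemma hamiltonian_derive x0 v x qT q t w :
  (forall w y, differentiable (fun z => F z w) y) ->
  mvec v -> (forall s, U (v s)) -> U w -> solves F T x0 v x -> adjoint_solves F T x v qT q ->
  0 < t < T ->
  is_derive t (1 : R) (prim (fun s => pairing (q s) (F (x s) (v s))))
    (pairing (q t) (F (x t) (v t))) ->
  is_derive t (1 : R) (prim (fun s => pairing (q s) (F (x s) w - F (x s) (v s))))
    (pairing (q t) (F (x t) w) - pairing (q t) (F (x t) (v t))).
Proof.
move=> F_diff mv Uv Uw [bx Hx] [bq Hq] tT dv.
have bF := bvec_F U_compact F_continuous L_gt0 F_lip bx.
have bw : bvec (fun s => F (x s) w).
  by apply: (bF (fun=> w)) => // k; exact: measurable_cst.
have bqA : bvec (fun s => q s *m (jac_along F x v s)^T).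
  apply: bvec_mulmx => // k l.
  exact: (bmeas_jac_alongT U_compact F_continuous L_gt0 F_lip F_diff).
have cx k : {for t, continuous (fun s => x s ord0 k)}.
  exact: (prim_continuous (bF _ mv Uv k) (Hx^~ k) tT).
have cq k : {for t, continuous (fun s => q s ord0 k)}.
  apply: (@prim_continuous R _ (fun s => - (q s *m (jac_along F x v s)^T) ord0 k)
   (qT ord0 k + prim (fun s => (q s *m (jac_along F x v s)^T) ord0 k) T) T) => //.
    exact: bmeasN (bqA k).
  by move=> s sT; rewrite Hq // (primN _ (bqA k)) addrA.
have cxt : {for t, continuous x} by apply: cvg_coord => k; exact: cx.
have cw k : {for t, continuous (fun s => F (x s) w ord0 k)}.
  apply: (@continuous_comp _ _ _ x (fun z => F z w ord0 k)) => //.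
  apply: (@continuous_comp _ _ _ (fun z => F z w) (fun z => z ord0 k)).
    exact: differentiable_continuous.
  exact: coord_continuous.
have dw : is_derive t (1 : R) (prim (fun s => pairing (q s) (F (x s) w)))
    (pairing (q t) (F (x t) w)).
  apply: (continuous_prim_derive (f := fun s => pairing (q s) (F (x s) w))).
  - exact: bmeas_pairing.
  - by case/andP: tT.
  - by apply: cvg_pairing => k; [exact: cq | exact: cw].
have -> : prim (fun s => pairing (q s) (F (x s) w - F (x s) (v s))) =
  (fun t => prim (fun s => pairing (q s) (F (x s) w)) t -
            prim (fun s => pairing (q s) (F (x s) (v s))) t).
  apply/funext => s; rewrite -primB; try exact: bmeas_pairing.
    by apply: eq_prim => s' _; rewrite pairingB.
  by apply: bmeas_pairing => //; exact: bF.
exact: is_deriveB.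
Qed.

End Admissibility.

(** The distance is Euclidean in all coordinates, whereas perturbations are bounded curve by curve
    in the sup-norm; M N d comes from crude norm comparison and the 1 keeps the divisor positive. *)
Lemma dist_C0_le (R : realType) (d M N : nat) (T e : R) (X Y : 'I_M -> 'I_N -> R -> 'rV[R]_d) :
  0 <= e -> (forall i j t, 0 <= t <= T -> `|X i j t - Y i j t| <= e / ((M * N)%:R * d%:R + 1)) ->
  (dist_C0 T X Y <= e%:E)%E.
Proof.
move=> e0 H; apply: ge_ereal_sup => _ [t /= + <-].
rewrite in_itv /= => tT; rewrite lee_fin.
have c1 : 0 < (M * N)%:R * d%:R + 1 :> R by rewrite ltr_wpDl // mulr_ge0.
rewrite -[leRHS](ger0_norm e0) -sqrtr_sqr; apply: ler_wsqrtr.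
pose b := d%:R * (e / ((M * N)%:R * d%:R + 1)).
have b0 : 0 <= b by rewrite mulr_ge0 // divr_ge0 // ltW.
apply: (@le_trans _ _ (\sum_(i < M) \sum_(j < N) b ^+ 2)).
  apply: ler_sum => i _; apply: ler_sum => j _.
  apply: lerXn2r; rewrite ?nnegrE ?enorm_ge0 //.
  by apply: le_trans (enorm_le_norm _) _; rewrite ler_wpM2l //; exact: H.
rewrite !sumr_const !card_ord -mulrnA -mulr_natl mulnC.
apply: (@le_trans _ _ (((M * N)%:R * b) ^+ 2)).
  rewrite [leRHS]exprMn ler_wpM2r ?sqr_ge0 // -natrX ler_nat.
  by case: (M * N)%N => // k; rewrite expnS leq_pmulr // expn_gt0.
apply: lerXn2r; rewrite ?nnegrE ?mulr_ge0 //.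
have -> : (M * N)%:R * b = e * ((M * N)%:R * d%:R / ((M * N)%:R * d%:R + 1)).
  by rewrite /b; ring.
by rewrite ler_piMr // ler_pdivrMr // mul1r lerDl.
Qed.

Unset Implicit Arguments.
Set Strict Implicit.

Theorem theorem3 (R : realType) (d m M N : nat) (T : R)
    (U : set 'rV[R]_m.+1)
    (F : 'rV[R]_d.+1 -> 'rV[R]_m.+1 -> 'rV[R]_d.+1) (C : R)
    (g : 'I_M.+1 -> 'rV[R]_d.+1 -> R)
    (x0 : 'I_M.+1 -> 'rV[R]_d.+1)
    (alpha : 'I_M.+1 -> 'I_N.+1 -> 'rV[R]_d.+1)
    (ubar : R -> 'rV[R]_m.+1)
    (Xbar : 'I_M.+1 -> 'I_N.+1 -> R -> 'rV[R]_d.+1)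
    (T_gt0 : 0 < T)
    (U_compact : compact U)
    (F_continuous : continuous
      (fun z : 'rV[R]_d.+1 * 'rV[R]_m.+1 => F z.1 z.2))
    (F_C2 : forall w, C2 (fun x => F x w))
    (C_gt0 : 0 < C)
    (F_lipschitz : forall x y w,
      enorm (F x w - F y w) <= C * (enorm w + 1) * enorm (x - y))
    (g_convex : forall i, convex_function setT (g i))
    (g_C1 : forall i, C1 (g i))
    (g_bounded_below : forall i, has_lbound (range (g i)))
    (minimizer : strong_local_minimizer T U F g x0 alpha ubar Xbar) :
  exists (gamma : 'I_M.+1 -> 'I_N.+1 -> R)
         (P : 'I_M.+1 -> 'I_N.+1 -> R -> 'rV[R]_d.+1),
    [/\ forall i, (forall j, 0 <= gamma i j) /\ \sum_(j < N.+1) gamma i j = 1,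
        forall i j, adjoint_curve T F ubar (Xbar i j)
          (- ((M.+1%:R^-1 * gamma i j) *: grad (g i) (Xbar i j T))) (P i j),
        \forall t \ae (@lebesgue_measure R), t \in `[0, T] ->
          is_max [set hamiltonian F (fun i j => Xbar i j t)
                        (fun i j => P i j t) w | w in U]
                 (hamiltonian F (fun i j => Xbar i j t)
                        (fun i j => P i j t) (ubar t)) &
        forall i j, 0 < gamma i j -> argmax (fun k => g i (Xbar i k T)) j].
Proof.
have [[ctl traj] [e e0 Hmin]] := minimizer.
have [L L0 FL] := uniform_lipschitz U_compact C_gt0 F_lipschitz.
have [v [mv Uv uv]] := control_regularize U_compact T_gt0 ctl.
have T0 := ltW T_gt0; have T0T : 0 <= T <= T by rewrite T0 lexx.
(* Only the restriction of [Xbar] to [0, T] is controlled; its clamped extension is bounded and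
   measurable everywhere. *)
pose x i j t := Xbar i j (clamp T t).
have xT i j : x i j T = Xbar i j T by rewrite /x clamp_id.
have Fd w y : differentiable (fun z => F z w) y by have [[]] := F_C2 w.
have sx i j : solves F T (x0 i + alpha i j) v (x i j).
  exact: (trajectory_solves U_compact F_continuous L0 FL T_gt0 mv Uv uv (traj i j)).
have xc i j t : x i j (clamp T t) = x i j t by rewrite /x clampK.
have M0 : 0 < M.+1%:R :> R by [].
have /choice[q aq] : forall p, exists q, adjoint_solves F T (x p.1 p.2) v
    (- (M.+1%:R^-1 *: grad (g p.1) (x p.1 p.2 T))) q.
  move=> [i j]; have [bx _] := sx i j.
  exact: (adjoint_exists U_compact F_continuous L0 FL Fd T_gt0).
have minimal : exists2 e, 0 < e & forall u y, mvec u -> (forall s, U (u s)) ->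
    (forall i j, solves F T (x0 i + alpha i j) u (y i j)) ->
    (forall i j t, `|y i j t - x i j t| <= e) ->
    \sum_i ord_max_val (fun j => g i (x i j T)) <= \sum_i ord_max_val (fun j => g i (y i j T)).
  exists (e / ((M.+1 * N.+1)%:R * d.+1%:R + 1)).
    by rewrite divr_gt0 // ltr_wpDl // mulr_ge0.
  move=> u y mu_ Uu sy yx.
  have : cost T g Xbar <= cost T g y.
    apply: (Hmin u); first split.
    - exact: mvec_control.
    - by move=> i j; exact: (solves_trajectory U_compact F_continuous L0 FL T_gt0).
    - apply: dist_C0_le => [|i j t tT]; first exact: ltW.
      by have := yx i j t; rewrite /x clamp_id.
  rewrite /cost ler_pM2l ?invr_gt0 //.
  by under eq_bigr do under eq_fun do rewrite -xT.
have gd i j : differentiable (g i) (x i j T) by have [+ _] := g_C1 i; exact.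
have [gam [gam0 gam1 gamA] Hgam] := common_multiplier U_compact F_continuous L0 FL Fd T_gt0 M0
  mv Uv sx xc gd (fun i j => aq (i, j)) minimal.
exists gam, (fun i j t => gam i j *: q (i, j) t); split.
- by move=> i; split.
- move=> i j; have [bx _] := sx i j.
  have := adjoint_solves_curve U_compact F_continuous L0 FL T_gt0 (gam i j) Fd mv Uv uv bx (aq (i, j)).
  by rewrite /= xT scalerN scalerA mulrC.
- have aeF := ae_filter_ringOfSetsType (@lebesgue_measure R).
  (* Together with the endpoints and the times where [ubar] differs from [v], these are the only
     exceptional times, fixed before [w] is chosen. *)
  have aed : {ae (@lebesgue_measure R), forall t : R, forall p, 0 < t -> is_derive t (1 : R)
      (prim (fun s => pairing (q p s) (F (x p.1 p.2 s) (v s))))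
      (pairing (q p t) (F (x p.1 p.2 t) (v t)))}.
    apply: ae_forall => -[i j]; have [bq _] := aq (i, j); have [bx _] := sx i j.
    apply: (prim_ae (h := fun s => pairing (q (i, j) s) (F (x i j s) (v s)))).
    by apply: bmeas_pairing => //; exact: (bvec_F U_compact F_continuous L0 FL).
  apply: filterS3 (ae_itv_interior 0 T) uv aed => t t0T ut dt tT.
  have t_in := t0T tT; have {}ut := ut tT; have t0 : 0 < t by case/andP: t_in.
  have xt i j : x i j t = Xbar i j t.
    by rewrite /x clamp_id //; move: tT; rewrite in_itv.
  split; first by exists (ubar t) => //; rewrite ut; exact: Uv.
  move=> _ [w Uw <-]; rewrite ut -subr_le0.
  (* Weighted by [gam], these increments sum to the Hamiltonian at [w] minus the Hamiltonian at
     [v t]. *)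
  have := Hgam t w (fun i j => pairing (q (i, j) t) (F (x i j t) w) -
    pairing (q (i, j) t) (F (x i j t) (v t))) t_in Uw.
  have dh i j := hamiltonian_derive U_compact F_continuous L0 FL Fd mv Uv Uw (sx i j)
    (aq (i, j)) t_in (dt (i, j) t0).
  move=> /(_ dh); apply: le_trans; rewrite le_eqVlt; apply/orP; left; apply/eqP.
  rewrite /hamiltonian -sumrB; apply: eq_bigr => i _; rewrite -sumrB.
  by apply: eq_bigr => j _; rewrite !pairingZl xt mulrBr.
- by move=> i j /gamA; rewrite (_ : (fun k => g i (x i k T)) = (fun k => g i (Xbar i k T)));
    last by apply/funext => k; rewrite xT.
Qed.
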